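(* Let $0<\kappa\le1/2$ and $p>1$. For $r\ge0$ consider $$S_{\rm hyp}(r)=\tanh(\kappa r),\quad S_{\rm exp}(r)=1-e^{-\kappa r},\quad S_{\rm alg}(r)=\frac{\kappa r}{\sqrt{1+\kappa^2r^2}},\quad S_{\rm poly}(r)=1-\left(1+\frac{\kappa r}{p}\right)^{-p}.$$ Each of these functions $S$ maps $[0,+\infty)$ into $[0,1)$, is continuously differentiable, nondecreasing and concave with $S(0)=0$, and satisfies $0<2S'(r)+S(r)^2\le1$ for all $r\ge0$, $S'(0)=\kappa$, $S(r)\to1$ and $S'(r)\to0$ as $r\to+\infty$, and $\int_0^{+\infty}(1-S(r))\,dr<+\infty$. Let $\mathcal H$ be a real Hilbert space and $\Phi=f+g$, where $f:\mathcal H\to\mathbb R$ is continuously Fréchet differentiable and $\mu$-strongly convex with $\mu>0$, $\nabla f$ is $L$-Lipschitz continuous ($L>0$, $\mu<L$), $g:\mathcal H\to(-\infty,+\infty]$ is proper, lower semicontinuous and convex, and $\operatorname{argmin}\Phi\neq\varnothing$, with $\Phi^*=\min\Phi$. Let $0<s\le1/L$. For any $S\in\{S_{\rm hyp},S_{\rm exp},S_{\rm alg},S_{\rm poly}\}$, define $$\theta_{k+1}=\frac1{\sqrt\mu}\left[\sqrt{s\mu}+\bigl(1-\sqrt{s\mu}\bigr)S\bigl(k\sqrt{s\mu}\bigr)\right],\quad k\ge0,\qquad\beta_k=\frac{(\theta_k-\sqrt s)\bigl(1-\mu\sqrt s\,\theta_{k+1}\bigr)}{(1-s\mu)\theta_{k+1}},\quad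 k\ge1,$$ and generate $\{x_k\}$ by either the one-sequence scheme or the two-sequence scheme (both defined in the context). Let $\gamma=1+\frac1\kappa\ge3$. Then $$\beta_k\to\frac{k-1}{k+\gamma-1}\ \text{ as }\mu\downarrow0\text{ for each fixed }k\ge1,\qquad\beta_k\to\frac{1-\sqrt{s\mu}}{1+\sqrt{s\mu}}\ \text{ as }k\to+\infty\text{ for each fixed }\mu>0.$$ Moreover, $$\Phi(x_k)-\Phi^*=\mathcal O\left(\min\left\{\frac1{k^2},\bigl(1-\sqrt{s\mu}\bigr)^k\right\}\right).$$
   Context: Strong convexity: $f(y)\ge f(x)+\langle\nabla f(x),y-x\rangle+\frac\mu2\|y-x\|^2$ for all $x,y\in\mathcal H$. Proximal map: $\operatorname{prox}_{\lambda g}(u)=\operatorname{argmin}_{v\in\mathcal H}\{g(v)+\frac1{2\lambda}\|v-u\|^2\}$, $\lambda>0$. Both schemes are initialized with $x_0=x_1=z_1\in\operatorname{dom}g$ and use, for $k\ge1$, $y_k=x_k+\beta_k(x_k-x_{k-1})$. One-sequence scheme: $x_{k+1}=\operatorname{prox}_{sg}\bigl(y_k-s\nabla f(y_k)\bigr)$. Two-sequence scheme: $$z_{k+1}=\operatorname{prox}_{\sqrt s\,\theta_{k+1}g}\Bigl(z_k-\mu\sqrt s\,\theta_{k+1}(z_k-y_k)-\sqrt s\,\theta_{k+1}\nabla f(y_k)\Bigr),\qquad x_{k+1}=\left(1-\frac{\sqrt s}{\theta_{k+1}}\right)x_k+\frac{\sqrt s}{\theta_{k+1}}z_{k+1}.$$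 In the limit $\mu\downarrow0$, $s$ and $S$ are fixed, and $\theta_k$, $\beta_k$ are regarded as functions of $\mu$ through their explicit formulas. The constant in $\mathcal O$ may depend on $s,\mu,S$, the problem and the initial point. *)

(* Defs.v *)
From HB Require Import structures.
From mathcomp Require Import all_boot all_order all_algebra.
From mathcomp Require Import all_classical all_reals all_analysis.

Set Implicit Arguments.
Unset Strict Implicit.
Unset Printing Implicit Defensive.

Import Order.TTheory GRing.Theory Num.Theory.
Import numFieldNormedType.Exports.

Local Open Scope classical_set_scope.
Local Open Scope ring_scope.

Section Profiles.
Context {R : realType}.
Implicit Types (kappa p r : R) (S : R -> R).

Definition tanh (x : R) : R := (expR x - expR (- x)) / (expR x + expR (- x)).

Definition S_hyp kappa r : R := tanh (kappa * r).
Definition S_exp kappa r : R := 1 - expR (- (kappa * r)).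
Definition S_alg kappa r : R := kappa * r / Num.sqrt (1 + kappa ^+ 2 * r ^+ 2).
Definition S_poly kappa p r : R := 1 - (1 + kappa * r / p) `^ (- p).

Definition profiles kappa p : set (R -> R) :=
  [set S_hyp kappa; S_exp kappa; S_alg kappa; S_poly kappa p].

(* The profiles are given by formulas that remain smooth on a neighbourhood of
   0, so derive1 S is the derivative on [0, +oo[, endpoint included. *)
Record profile_properties kappa S : Prop := ProfileProperties {
  profile_range : forall r, 0 <= r -> 0 <= S r < 1;
  profile_derivable : forall r, 0 <= r -> derivable S r 1;
  profile_derive_continuous : {within `[0, +oo[, continuous derive1 S};
  profile_nondecreasing : {in `[0, +oo[ &, {homo S : r t / r <= t}};
  profile_concave : convex_function (`[0, +oo[%classic : set R) (fun r => - S r);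
  profile_0 : S 0 = 0;
  profile_ineq : forall r, 0 <= r -> 0 < 2 * derive1 S r + S r ^+ 2 <= 1;
  profile_derive_0 : derive1 S 0 = kappa;
  profile_cvg : S r @[r --> +oo] --> (1 : R);
  profile_derive_cvg : derive1 S r @[r --> +oo] --> (0 : R);
  profile_integral :
    (\int[lebesgue_measure]_(r in `[0%R, +oo[) (1 - S r)%:E < +oo)%E
}.

(* Only the values at k >= 1 are meaningful: theta S s mu k.+1 is the
   coefficient built from S (k * sqrt (s * mu)). *)
Definition theta S (s mu : R) (k : nat) : R :=
  (Num.sqrt mu)^-1 *
  (Num.sqrt (s * mu)
   + (1 - Num.sqrt (s * mu)) * S (k.-1%:R * Num.sqrt (s * mu))).

Definition beta S (s mu : R) (k : nat) : R :=
  (theta S s mu k - Num.sqrt s) * (1 - mu * Num.sqrt s * theta S s mu k.+1)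
  / ((1 - s * mu) * theta S s mu k.+1).

End Profiles.

Section Minimization.
Context {R : realType} {H : completeNormedModType R}.
Implicit Types (F g : H -> \bar R) (u v w x y : H).

Definition argmin F : set H := [set v | forall w, (F v <= F w)%E].

Definition edomain g : set H := [set x | (g x < +oo)%E].

Definition proper_efun g : Prop := (forall x, g x != -oo%E) /\ edomain g !=set0.

Definition econvex g : Prop := forall x y (t : R), 0 < t < 1 ->
  (g (t *: x + (1 - t) *: y)%R <= t%:E * g x + (1 - t)%:E * g y)%E.

(* The default value 0 is only taken when there is no minimizer, which does not
   happen for lambda > 0 and g proper, lower semicontinuous and convex; the
   minimizer is then unique. *)
Definition prox (lambda : R) g u : H :=
  xget 0 (argmin (fun v => g v + ((2 * lambda)^-1 * `|v - u| ^+ 2)%:E)%E).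

End Minimization.

Section Gradient.
Context {R : realType} {H : completeNormedModType R}.
Variables (ip : {dot H for idfun}) (f : H -> R).

(* Riesz representative of the Frechet differential; it exists, and is unique,
   wherever f is differentiable and the norm of H is the one induced by ip. *)
Definition grad (x : H) : H := xget 0 [set w | forall v, ip w v = 'd f x v].

Definition continuously_differentiable : Prop := (forall x, differentiable f x) /\ continuous grad.

Definition strongly_convex (mu : R) : Prop := forall x y,
  f x + ip (grad x) (y - x) + mu / 2 * `|y - x| ^+ 2 <= f y.

End Gradient.

Section Schemes.
Context {R : realType} {H : completeNormedModType R}.
Variables (ip : {dot H for idfun}) (f : H -> R) (g : H -> \bar R).
Variables (S : R -> R) (s mu : R).
Implicit Types x z : nat -> H.

Definition extrapolation x (k : nat) : H :=
  x k + beta S s mu k *: (x k - x k.-1).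

Definition one_sequence x : Prop :=
  [/\ edomain g (x 0%N), x 1%N = x 0%N &
   forall k, (1 <= k)%N ->
     let y := extrapolation x k in
     x k.+1 = prox s g (y - s *: grad ip f y)].

Definition two_sequence x z : Prop :=
  [/\ edomain g (x 0%N), x 1%N = x 0%N, z 1%N = x 0%N &
   forall k, (1 <= k)%N ->
     let y := extrapolation x k in
     let tau := Num.sqrt s * theta S s mu k.+1 in
     let rho := Num.sqrt s / theta S s mu k.+1 in
     z k.+1 = prox tau g (z k - (mu * tau) *: (z k - y) - tau *: grad ip f y)
     /\ x k.+1 = (1 - rho) *: x k + rho *: z k.+1].

End Schemes.

(* Main.v *)
Require Import Defs.
From mathcomp Require Import all_boot all_order all_algebra.
From mathcomp Require Import all_classical all_reals all_analysis.
From mathcomp Require Import measurable_realfun ring lra.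

Set Implicit Arguments.
Unset Strict Implicit.
Unset Printing Implicit Defensive.

Import Order.TTheory GRing.Theory Num.Theory.
Import numFieldNormedType.Exports.

Local Open Scope classical_set_scope.
Local Open Scope ring_scope.

(** Every profile solves an autonomous equation S' = kappa phi(S) with phi
    nonincreasing, hence concavity, and with
    (1 - t)^(1 + alpha) <= phi t <= 1 - t^2 on [0, 1[ for some alpha < 1.  The
    upper bound gives 2 S' + S^2 <= 1 because 2 kappa <= 1.  The lower bound
    makes - (1 - S)^(1 - alpha) / (kappa (1 - alpha)) a bounded function whose
    derivative dominates 1 - S, which is the integrability of 1 - S.
    [autonomous_profile] draws all the properties of a profile from this.

    Put q = sqrt (s mu) and T_n = q + (1 - q) S (n q), so that
    theta_(n+1) = T_n / sqrt mu.  With a = q / T_n and b = q T_n, both schemes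
    read x_(n+1) = (1 - a) x_n + a z_(n+1), where z is the second sequence when
    there is one and is defined by this relation otherwise; the extrapolation
    coefficient is exactly the one for which the forward-backward step is taken
    at a fixed combination of x and z ([extrapolation_mix]).  Adding up the
    descent inequality of f, its strong convexity at two points and the
    variational inequality of the proximal map then makes all gradient terms
    cancel ([accelerated_step]).  What remains says that
        (2 / mu) T_n^2 (Phi (x_(n+1)) - min Phi) + |z_(n+1) - x*|^2
    is multiplied by at most 1 - q T_(n+1) at each step, as soon as
    T_(n+1)^2 - q T_(n+1) <= (1 - q T_(n+1)) T_n^2; by the mean value theorem
    this is what 2 S' + S^2 <= 1 provides ([damping_growth]).

    Finally 1 - q T_j = (1 - q) (1 + q (1 - S (j q))), and the sum of the
    q (1 - S (j q)) is at most the integral of 1 - S, so the product of the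
    contraction factors is O((1 - q)^n) ([prod_damping_le]).  The constant may
    depend on mu, so this geometric bound also yields the bound in 1 / k^2.

    The descent inequality comes from strong convexity and the Lipschitz bound
    by repeated halving of the step ([descent_halving]).  The minimizer x* of
    f + g supplies an affine minorant of g, with slope minus the gradient of f
    at x* ([minimizer_minorant]), and this is what makes the proximal objective
    bounded below; its minimizer is then the limit of a minimizing sequence,
    which is a Cauchy sequence by the parallelogram law. *)

(** * Profiles as solutions of an autonomous differential equation *)

Lemma MVT_ray {R : realType} (f df : R -> R) (a b : R) : 0 <= a -> a <= b ->
  (forall r : R, 0 <= r -> is_derive r 1 f (df r)) ->
  exists2 c, a <= c <= b & f b - f a = df c * (b - a).
Proof.
move=> a0 ab f_df.
have [||c hc E] := @MVT_segment R f df a b ab.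
- by move=> r; rewrite in_itv /= => /andP[ar _]; apply: f_df; lra.
- apply: derivable_within_continuous => r; rewrite in_itv /= => /andP[ar _].
  by case: (f_df r (le_trans a0 ar)).
by move: hc; rewrite in_itv /= => hc; exists c.
Qed.

(** The exponent alpha < 1 measures how slowly S may approach 1: the weaker
    the lower bound on phi, the heavier the tail of 1 - S, and alpha = 1 would
    allow a tail in 1 / r, which is not integrable. *)
Section AutonomousProfile.
Context {R : realType}.
Variables (kappa alpha : R) (phi S : R -> R).
Implicit Types r t u a b : R.
Hypotheses (kappa_bd : 0 < kappa <= 2^-1) (alpha_bd : 0 <= alpha < 1).
Hypothesis phi_continuous : forall t : R, 0 <= t < 1 -> {for t, continuous phi}.
Hypothesis phi_nonincreasing :
  forall t u : R, 0 <= t -> t <= u -> u < 1 -> phi u <= phi t.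
Hypothesis phi_bounds :
  forall t : R, 0 <= t < 1 -> (1 - t) `^ (1 + alpha) <= phi t <= 1 - t ^+ 2.
Hypothesis S0 : S 0 = 0.
Hypothesis S_range : forall r : R, 0 <= r -> 0 <= S r < 1.
Hypothesis S_ode : forall r : R, 0 <= r -> is_derive r 1 S (kappa * phi (S r)).

Let kappa_gt0 : 0 < kappa. Proof. by case/andP: kappa_bd. Qed.

Let phi_gt0 t : 0 <= t < 1 -> 0 < phi t.
Proof.
move=> t01; have /andP[h _] := phi_bounds t01.
by apply: lt_le_trans h; apply: powR_gt0; move: t01; lra.
Qed.

Let dS r : 0 <= r -> derive1 S r = kappa * phi (S r).
Proof. by move=> r0; rewrite derive1E; case: (S_ode r0). Qed.

Let S_continuous r : 0 <= r -> {for r, continuous S}.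
Proof.
move=> r0; apply: differentiable_continuous; apply/derivable1_diffP.
by case: (S_ode r0).
Qed.

Let S_mono a b : 0 <= a -> a <= b -> S a <= S b.
Proof.
move=> a0 ab; have [c hc E] := MVT_ray a0 ab S_ode.
rewrite -subr_ge0 E mulr_ge0 ?subr_ge0//.
apply: mulr_ge0; first exact: ltW.
by apply/ltW/phi_gt0/S_range; move: hc; lra.
Qed.

Let dS_antimono a b : 0 <= a -> a <= b -> kappa * phi (S b) <= kappa * phi (S a).
Proof.
move=> a0 ab; rewrite ler_pM2l//; apply: phi_nonincreasing.
- by have /andP[] := S_range a0.
- exact: S_mono.
- by have /andP[] := S_range (le_trans a0 ab).
Qed.

(* The derivative kappa phi(S) is nonincreasing, so the graph lies below its
   tangents; concavity follows by averaging two tangent inequalities taken at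
   the intermediate point. *)
Let S_tangent a b : 0 <= a -> 0 <= b ->
  S b <= S a + kappa * phi (S a) * (b - a).
Proof.
move=> a0 b0; rewrite -lerBlDl; have [ab|/ltW ba] := leP a b.
  have [c /andP[ac cb] ->] := MVT_ray a0 ab S_ode.
  by rewrite ler_wpM2r ?subr_ge0//; exact: dS_antimono.
have [c /andP[bc ca] E] := MVT_ray b0 ba S_ode.
have ab0 : 0 <= a - b by rewrite subr_ge0.
have := ler_wpM2r ab0 (dS_antimono (le_trans b0 bc) ca).
by move: E; lra.
Qed.

Let S_concave : convex_function (`[0, +oo[%classic : set R) (fun r => - S r).
Proof.
have concave (u x y : R) : 0 <= u -> 0 <= 1 - u -> 0 <= x -> 0 <= y ->
    u * S x + (1 - u) * S y <= S (u * x + (1 - u) * y).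
  move=> u0 u1 x0 y0.
  have z0 : 0 <= u * x + (1 - u) * y by rewrite addr_ge0// mulr_ge0.
  have hx := ler_wpM2l u0 (S_tangent z0 x0).
  have hy := ler_wpM2l u1 (S_tangent z0 y0).
  by apply: (le_trans (lerD hx hy)); rewrite le_eqVlt; apply/orP; left; apply/eqP; ring.
move=> t x y; rewrite !inE/= !in_itv/= !andbT => x0 y0.
rewrite -[leRHS]/(t%:num * - S x + (1 - t%:num) * - S y) !mulrN -opprD lerN2.
by apply: concave => //; rewrite subr_ge0.
Qed.

Let M : R := (kappa * (1 - alpha))^-1.
(* Separating variables, the integral of 1 - S becomes that of
   (1 - t) / (kappa phi t) over [0, 1[, at most the integral of
   (1 - t)^(- alpha) / kappa; G is that primitive, evaluated at S. *)
Let G r := - (1 - S r) `^ (1 - alpha) * M.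
Let dG r := (1 - S r) `^ (- alpha) * phi (S r).

Let M_gt0 : 0 < M.
Proof. by rewrite invr_gt0 mulr_gt0//; move: alpha_bd; lra. Qed.

Let G_derive r : 0 <= r -> is_derive r 1 G (dG r).
Proof.
move=> r0; have /andP[S_ge0 S_lt1] := S_range r0.
have p0 : 0 < 1 - S r by rewrite subr_gt0.
have dh : is_derive r 1 (fun x => 1 - S x) (0 - kappa * phi (S r)).
  by apply: is_deriveB; exact: S_ode.
have dp := @is_derive1_comp R (fun y => y `^ (1 - alpha)) (fun x => 1 - S x)
  _ _ _ (is_derive1_powR (1 - alpha) p0) dh.
have dN := @is_deriveN _ _ _ _ _ _ _ dp.
have -> : G = (M *: (- ((fun y => y `^ (1 - alpha)) \o (fun x => 1 - S x)))).
  by apply/funext => x; rewrite /G /= mulrC.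
have := @is_deriveZ _ _ _ _ M _ _ _ dN.
congr (is_derive _ _ _ _); rewrite /dG /M /=.
rewrite [_ - _ - 1]addrAC subrr sub0r -[_ *: _]/(_ * _).
field.
by rewrite (gt_eqF kappa_gt0) subr_eq0 eq_sym lt_eqF; case/andP: alpha_bd.
Qed.

Let G_le0 r : G r <= 0.
Proof. by rewrite /G mulNr oppr_le0 mulr_ge0 ?powR_ge0//; exact: ltW. Qed.

Let G0 : G 0 = - M.
Proof. by rewrite /G S0 subr0 powR1 mulN1r. Qed.

Let le_dG r : 0 <= r -> 1 - S r <= dG r.
Proof.
move=> r0; have r01 := S_range r0; have /andP[h _] := phi_bounds r01.
have p0 : 0 < 1 - S r by move: r01; lra.
rewrite /dG powRN mulrC ler_pdivlMr ?powR_gt0//.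
apply: le_trans h; rewrite powRD ?powRr1//; first exact: ltW.
by rewrite (gt_eqF p0) implybT.
Qed.

(* 1 - S is nonincreasing and G bounded, so r (1 - S r) <= G r - G 0 <= M. *)
Let S_cvg : S r @[r --> +oo] --> (1 : R).
Proof.
have bnd r : 0 < r -> 1 - M * r^-1 <= S r <= 1.
  move=> r0; have r0' := ltW r0.
  have [c /andP[c0 cr] E] := MVT_ray (lexx 0) r0' G_derive.
  have /andP[_ S1] := S_range r0'; rewrite (ltW S1) andbT.
  suff : 1 - S r <= M / r by lra.
  rewrite ler_pdivlMr//.
  apply: (@le_trans _ _ (dG c * (r - 0))).
    rewrite subr0 ler_pM2r//; apply: le_trans (le_dG c0).
    by rewrite lerD2l lerN2; exact: S_mono.
  by rewrite -E G0 opprK gerDr.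
apply: (@squeeze_cvgr _ _ _ _ (fun r => 1 - M * r^-1) (fun=> 1)).
- by near=> r; apply: bnd; near: r; exact: nbhs_pinfty_gt.
- rewrite -[X in _ --> X](subr0 (1 : R)); apply: cvgB; first exact: cvg_cst.
  rewrite -[X in _ --> X](mulr0 M); apply: cvgMr.
  apply/(@gtr0_cvgV0 R R +oo _ id); last exact: cvg_id.
  exact: nbhs_pinfty_gt.
- exact: cvg_cst.
Unshelve. all: by end_near. Qed.

Let dS_ineq r : 0 <= r -> 0 < 2 * derive1 S r + S r ^+ 2 <= 1.
Proof.
move=> r0; rewrite dS//; have S01 := S_range r0.
have /andP[_ phi_le] := phi_bounds S01; have phi0 := phi_gt0 S01.
apply/andP; split.
  by rewrite ltr_pwDl ?sqr_ge0// !mulr_gt0.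
have : (2 * kappa) * phi (S r) <= 1 * phi (S r).
  by rewrite ler_pM2r//; move: kappa_bd; lra.
lra.
Qed.

Let dS_cvg : derive1 S r @[r --> +oo] --> (0 : R).
Proof.
apply: (@squeeze_cvgr _ _ _ _ (fun=> 0) (fun r => 2^-1 * (1 - S r * S r))).
- near=> r.
  have r0 : 0 <= r by near: r; exact: nbhs_pinfty_ge.
  have := dS_ineq r0; rewrite {1}dS//.
  have := mulr_gt0 kappa_gt0 (phi_gt0 (S_range r0)); rewrite -dS//.
  by rewrite expr2; lra.
- exact: cvg_cst.
- rewrite (_ : (0 : R) = 2^-1 * (1 - 1 * 1)); last by rewrite mulr1 subrr mulr0.
  by apply: cvgMr; apply: cvgB; [exact: cvg_cst|exact: cvgM].
Unshelve. all: by end_near. Qed.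

Let ray_continuous (f : R -> R) :
  (forall r, 0 <= r -> {for r, continuous f}) -> {within `[0, +oo[, continuous f}.
Proof.
move=> cf; apply: continuous_in_subspaceT => r; rewrite inE/= in_itv/= andbT.
exact: cf.
Qed.

Let phiS_continuous r : 0 <= r -> {for r, continuous (phi \o S)}.
Proof.
by move=> r0; apply: continuous_comp; [exact: S_continuous|apply/phi_continuous/S_range].
Qed.

Let dG_continuous r : 0 <= r -> {for r, continuous dG}.
Proof.
move=> r0; apply: continuousM; last exact: phiS_continuous.
apply: (@continuous_comp _ _ _ (fun r => 1 - S r) (fun y => y `^ (- alpha))).
  by apply: continuousB; [exact: cvg_cst|exact: S_continuous].
have /andP[_ S1] := S_range r0.
apply: differentiable_continuous; apply/derivable1_diffP.
have p0 : 0 < 1 - S r by rewrite subr_gt0.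
by case: (is_derive1_powR (- alpha) p0).
Qed.

Let G_cvg : G r @[r --> +oo] --> (0 : R).
Proof.
have to0 : (fun r => 1 - S r) @ +oo --> (0 : R)^'+.
  move=> A A0; have : \forall y \near (0 : R), 0 < y -> A y by [].
  have cv : (fun r => 1 - S r) @ +oo --> (0 : R).
    by rewrite -[X in _ --> X](subrr (1 : R)); apply: cvgB => //; exact: cvg_cst.
  move=> /cv; rewrite !near_simpl => nA; near=> r.
  apply: (near nA r) => //; have r0 : 0 <= r by near: r; exact: nbhs_pinfty_ge.
  by have /andP[_] := S_range r0; rewrite subr_gt0.
have h1 : 0 < 1 - alpha by move: alpha_bd; lra.
rewrite (_ : (0 : R) = - 0 * M); last by rewrite oppr0 mul0r.
apply: cvgMl; apply: cvgN.
exact: (cvg_comp _ _ to0 (powR_cvg0 h1)).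
Unshelve. all: by end_near. Qed.

Let S_integral :
  (\int[lebesgue_measure]_(r in `[0%R, +oo[) (1 - S r)%:E < +oo)%E.
Proof.
have dG_ge0 r : 0 <= r -> 0 <= dG r.
  move=> r0; apply: le_trans (le_dG r0); have := S_range r0; lra.
have int_dG : (\int[lebesgue_measure]_(r in `[0%R, +oo[) (dG r)%:E = M%:E)%E.
  rewrite (@ge0_continuous_FTC2y _ _ G _ 0)//.
  - by rewrite G0 -EFinN -EFinD opprK add0r.
  - exact: ray_continuous.
  - by move=> r /ltW /G_derive[].
  - apply: cvg_at_right_filter; apply: differentiable_continuous.
    by apply/derivable1_diffP; case: (G_derive (lexx 0)).
  - move=> r; rewrite in_itv/= andbT => /ltW r0.
    by rewrite derive1E; case: (G_derive r0).
apply: le_lt_trans (ltry M); rewrite -int_dG; apply: ge0_le_integral => //.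
- by move=> r /=; rewrite in_itv/= andbT => /S_range; rewrite lee_fin; lra.
- apply/measurable_EFinP; apply: subspace_continuous_measurable_fun => //.
  by apply: ray_continuous => r r0; apply: continuousB; [exact: cvg_cst|exact: S_continuous].
- apply/measurable_EFinP; apply: subspace_continuous_measurable_fun => //.
  exact: ray_continuous.
- by move=> r /=; rewrite in_itv/= andbT lee_fin; exact: le_dG.
Qed.

Lemma autonomous_profile : profile_properties kappa S.
Proof.
split=> //.
- by move=> r /S_ode[].
- apply: (@subspace_eq_continuous _ _ _ (fun r => kappa * phi (S r))).
    by move=> r; rewrite inE/= in_itv/= andbT => /dS/esym.
  apply: ray_continuous => r r0.
  by apply: continuousM; [exact: cvg_cst|exact: phiS_continuous].
- by move=> r t; rewrite !in_itv/= !andbT => r0 _; exact: S_mono.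
- have z01 : 0 <= (0 : R) < 1 by rewrite lexx ltr01.
  have := phi_bounds z01.
  rewrite subr0 powR1 expr0n/= subr0 => phi0.
  by rewrite dS// S0 -(le_anti phi0) mulr1.
Qed.

End AutonomousProfile.

(** * The four profiles *)

Section Profiles.
Context {R : realType}.
Variables (kappa p : R).
Hypotheses (hkappa : 0 < kappa <= 2^-1) (hp : 1 < p).
Implicit Types r t u : R.

Let kappa_gt0 : 0 < kappa. Proof. by case/andP: hkappa. Qed.

Lemma is_derive_linear r : is_derive r 1 (fun x : R => kappa * x) kappa.
Proof.
have := @is_deriveZ _ _ _ _ kappa _ _ _ (is_derive_id r 1).
by rewrite -[_ *: _]/(_ * _) mulr1.
Qed.

Lemma S_exp_profile : profile_properties kappa (S_exp kappa).
Proof.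
apply: (@autonomous_profile _ kappa 0 (fun t => 1 - t)) => //.
- by rewrite lexx ltr01.
- move=> t _; apply: continuousB; [exact: cvg_cst|exact: cvg_id].
- by move=> t u _ tu _; lra.
- move=> t t01; rewrite addr0 powRr1 ?lexx /=; first nra.
  by rewrite subr_ge0 ltW//; case/andP: t01.
- by rewrite /S_exp mulr0 oppr0 expR0 subrr.
- move=> r r0; rewrite /S_exp.
  have := expR_gt0 (- (kappa * r)); have : expR (- (kappa * r)) <= 1.
    by rewrite -expR0 ler_expR oppr_le0 mulr_ge0// ltW.
  by move=> *; apply/andP; split; lra.
- move=> r r0; rewrite /S_exp opprB addrCA subrr addr0.
  have d1 := @is_deriveN _ _ _ _ _ _ _ (is_derive_linear r).
  have d2 := @is_derive1_comp R expR (fun x => - (kappa * x)) _ _ _ (is_derive_expR _) d1.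
  have := @is_deriveB _ _ _ _ _ _ _ _ _ (is_derive_cst (1 : R) r 1) d2.
  by rewrite sub0r mulrN opprK mulrC.
Qed.

(** The equation is tanh' = 1 - tanh^2, rescaled by kappa. *)
Lemma S_hyp_profile : profile_properties kappa (S_hyp kappa).
Proof.
have cosh_gt0 r : 0 < expR (kappa * r) + expR (- (kappa * r)).
  by rewrite addr_gt0// expR_gt0.
apply: (@autonomous_profile _ kappa 0 (fun t => 1 - t * t)) => //.
- by rewrite lexx ltr01.
- move=> t _; apply: continuousB; [exact: cvg_cst|].
  by apply: continuousM; exact: cvg_id.
- by move=> t u t0 tu u1; nra.
- move=> t t01; rewrite addr0 powRr1 ?lexx /=; first nra.
  by rewrite subr_ge0 ltW//; case/andP: t01.
- by rewrite /S_hyp /tanh mulr0 oppr0 subrr mul0r.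
- move=> r r0; rewrite /S_hyp /tanh; have c0 := cosh_gt0 r.
  have e0 := expR_gt0 (- (kappa * r)).
  have e1 : expR (- (kappa * r)) <= expR (kappa * r).
    by rewrite ler_expR; have := mulr_ge0 (ltW kappa_gt0) r0; lra.
  rewrite ltr_pdivrMr// mul1r; apply/andP; split; last lra.
  by rewrite divr_ge0 ?subr_ge0// ltW.
- move=> r r0.
  have d0 := is_derive_linear r.
  have d1 := @is_deriveN _ _ _ _ _ _ _ d0.
  have dp := @is_derive1_comp R expR (fun x => kappa * x) _ _ _ (is_derive_expR _) d0.
  have dm := @is_derive1_comp R expR (fun x => - (kappa * x)) _ _ _ (is_derive_expR _) d1.
  have ds := @is_deriveB _ _ _ _ _ _ _ _ _ dp dm.
  have dc := @is_deriveD _ _ _ _ _ _ _ _ _ dp dm.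
  have c0 := gt_eqF (cosh_gt0 r).
  have di := @is_deriveV R (fun x => expR (kappa * x) + expR (- (kappa * x)))
    _ _ _ (negbT c0) dc.
  apply: (is_derive_eq (is_deriveM ds di)); rewrite /S_hyp /tanh /= -![_ *: _]/(_ * _).
  rewrite -[(_ - _) r]/(expR (kappa * r) - expR (- (kappa * r))).
  by field; rewrite c0.
Qed.

(** Here 1 - S^2 = 1 / (1 + kappa^2 r^2), so S' is kappa (1 - S^2)^(3/2). *)
Lemma S_alg_profile : profile_properties kappa (S_alg kappa).
Proof.
have q_gt0 r : 0 < 1 + kappa ^+ 2 * r ^+ 2.
  by rewrite -exprMn ltr_pwDl// sqr_ge0.
have w_gt0 r : 0 < Num.sqrt (1 + kappa ^+ 2 * r ^+ 2) by rewrite sqrtr_gt0.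
have w2 r : Num.sqrt (1 + kappa ^+ 2 * r ^+ 2) ^+ 2 = 1 + kappa ^+ 2 * r ^+ 2.
  by rewrite sqr_sqrtr// ltW.
apply: (@autonomous_profile _ kappa 2^-1
  (fun t => (1 - t * t) * Num.sqrt (1 - t * t))) => //.
- by apply/andP; split; lra.
- have c t : {for t, continuous (fun t : R => 1 - t * t)}.
    apply: continuousB; [exact: cvg_cst|].
    by apply: continuousM; exact: cvg_id.
  move=> t _; apply: continuousM => //.
  by apply: continuous_comp => //; exact: sqrt_continuous.
- move=> t u t0 tu u1; apply: ler_pM; rewrite ?sqrtr_ge0//; first nra.
    nra.
  by apply: ler_wsqrtr; nra.
- move=> t /andP[t0 t1].
  have p0 : 0 < 1 - t by rewrite subr_gt0.
  rewrite powRD; last by rewrite (gt_eqF p0) implybT.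
  rewrite powRr1 ?powR12_sqrt ?(ltW p0)//; apply/andP; split.
    apply: ler_pM; rewrite ?sqrtr_ge0 ?(ltW p0)//; first nra.
    by apply: ler_wsqrtr; nra.
  rewrite expr2 -[leRHS]mulr1 ler_wpM2l//; first nra.
  by rewrite -[leRHS]sqrtr1 ler_wsqrtr//; nra.
- by rewrite /S_alg mulr0 mul0r.
- move=> r r0; have k0 := mulr_ge0 (ltW kappa_gt0) r0.
  rewrite /S_alg ltr_pdivrMr// mul1r; apply/andP; split.
    by apply: divr_ge0 => //; exact: ltW.
  by have := w2 r; have := w_gt0 r; nra.
- move=> r r0.
  have dq : is_derive r 1 (fun x => 1 + kappa ^+ 2 * x ^+ 2) (2 * kappa ^+ 2 * r).
    have dX := @is_deriveX R _ id 2 r 1 1 (is_derive_id _ _).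
    apply: (is_derive_eq (@is_deriveD _ _ _ _ _ _ _ _ _ (is_derive_cst (1 : R) r 1)
      (@is_deriveZ _ _ _ _ (kappa ^+ 2) _ _ _ dX))).
    by rewrite -![_ *: _]/(_ * _) /=; ring.
  have dw := @is_derive1_comp R Num.sqrt
    (fun x => 1 + kappa ^+ 2 * x ^+ 2) _ _ _ (is_derive1_sqrt (q_gt0 r)) dq.
  have w0 := gt_eqF (w_gt0 r).
  have di := @is_deriveV R (fun x => Num.sqrt (1 + kappa ^+ 2 * x ^+ 2))
    _ _ _ (negbT w0) dw.
  apply: (is_derive_eq (is_deriveM (is_derive_linear r) di)).
  rewrite /S_alg /= -![_ *: _]/(_ * _).
  have -> : 1 - kappa * r / Num.sqrt (1 + kappa ^+ 2 * r ^+ 2) *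
      (kappa * r / Num.sqrt (1 + kappa ^+ 2 * r ^+ 2)) =
      (Num.sqrt (1 + kappa ^+ 2 * r ^+ 2))^-1 ^+ 2.
    rewrite -[X in X - _](@divff _ (Num.sqrt (1 + kappa ^+ 2 * r ^+ 2) ^+ 2)); last first.
      by rewrite expf_eq0 /= w0.
    by rewrite {1}w2; field; rewrite w0.
  rewrite sqrtr_sqr ger0_norm ?invr_ge0; last exact: ltW.
  have {}w2 := w2 r; move: (Num.sqrt _) w0 w2 => w w0 w2.
  have -> : kappa * (w^-1 ^+ 2 * w^-1) = kappa * (w ^+ 2 - kappa ^+ 2 * r ^+ 2) / w ^+ 3.
    by rewrite w2 addrK mulr1; field; rewrite w0.
  by field; rewrite w0.
Qed.

(** The decay rate 1 - S = O(r^(- p)) corresponds to alpha = 1/p, and p > 1 is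
    exactly the condition alpha < 1. *)
Lemma S_poly_profile : profile_properties kappa (S_poly kappa p).
Proof.
have p_gt0 : 0 < p by apply: lt_trans hp.
have u_ge1 r : 0 <= r -> 1 <= 1 + kappa * r / p.
  by move=> r0; rewrite lerDl divr_ge0 ?(ltW p_gt0)// mulr_ge0// ltW.
have u_gt0 r : 0 <= r -> 0 < 1 + kappa * r / p.
  by move=> /u_ge1; apply: lt_le_trans.
apply: (@autonomous_profile _ kappa p^-1 (fun t => (1 - t) `^ (1 + p^-1))) => //.
- by rewrite invr_ge0 (ltW p_gt0) invf_lt1.
- move=> t /andP[t0 t1].
  have p0 : 0 < 1 - t by rewrite subr_gt0.
  apply: (@continuous_comp _ _ _ (fun t => 1 - t) (fun y => y `^ (1 + p^-1))).
    by apply: continuousB; [exact: cvg_cst|exact: cvg_id].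
  apply: differentiable_continuous; apply/derivable1_diffP.
  by case: (is_derive1_powR (1 + p^-1) p0).
- move=> t u t0 tu u1; apply: ge0_ler_powR; rewrite ?nnegrE ?subr_ge0 ?(ltW u1)//.
  + by rewrite addr_ge0// invr_ge0 ltW.
  + exact: le_trans (ltW u1).
  + by rewrite lerD2l lerN2.
- move=> t /andP[t0 t1]; rewrite lexx /=.
  apply: (@le_trans _ _ (1 - t)); last by nra.
  apply: ge1r_powR; first by apply/andP; split; lra.
  by rewrite lerDl invr_ge0 ltW.
- by rewrite /S_poly mulr0 mul0r addr0 powR1 subrr.
- move=> r r0; rewrite /S_poly powRN.
  have v0 : 0 < (1 + kappa * r / p) `^ p by rewrite powR_gt0 ?u_gt0.
  have v1 : 1 <= (1 + kappa * r / p) `^ p.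
    by rewrite -[leLHS](powRr0 (1 + kappa * r / p)) ler_powR ?u_ge1// ltW.
  rewrite subr_ge0 invf_le1// v1 /=.
  by rewrite ltrBlDr ltrDl invr_gt0.
- move=> r r0; have u0 := u_gt0 r r0.
  have dl : is_derive r 1 (fun x => 1 + kappa * x / p) (kappa / p).
    have -> : (fun x => 1 + kappa * x / p) = cst 1 + (p^-1 *: (fun x => kappa * x)).
      by apply/funext => x; rewrite /= mulrC.
    apply: (is_derive_eq (@is_deriveD _ _ _ _ _ _ _ _ _ (is_derive_cst (1 : R) r 1)
      (@is_deriveZ _ _ _ _ p^-1 _ _ _ (is_derive_linear r)))).
    by rewrite add0r -![_ *: _]/(_ * _) mulrC.
  have dp := @is_derive1_comp R (fun y => y `^ (- p))
    (fun x => 1 + kappa * x / p) _ _ _ (is_derive1_powR (- p) u0) dl.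
  apply: (is_derive_eq (@is_deriveB _ _ _ _ _ _ _ _ _ (is_derive_cst (1 : R) r 1) dp)).
  rewrite /S_poly opprB addrCA subrr addr0 sub0r -powRrM.
  have -> : - p * (1 + p^-1) = - p - 1.
    by rewrite mulrDr mulr1 mulNr divff// gt_eqF.
  by field; rewrite gt_eqF.
Qed.

Theorem profiles_properties S : profiles kappa p S -> profile_properties kappa S.
Proof.
move=> [[[->|->]|->]|->].
- exact: S_hyp_profile.
- exact: S_exp_profile.
- exact: S_alg_profile.
- exact: S_poly_profile.
Qed.

End Profiles.

(** * Summable damping *)

(** On each interval of length q the function is at least its value at the
    right end. *)
Lemma sum_le_integral {R : realType} (F : R -> R) (q : R) (n : nat) : 0 < q ->
  (forall r : R, 0 <= r -> 0 <= F r) ->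
  (forall r t : R, 0 <= r -> r <= t -> F t <= F r) ->
  measurable_fun (`[0, +oo[ : set R) F ->
  ((\sum_(j < n) q * F (j.+1%:R * q))%:E
     <= \int[lebesgue_measure]_(r in `[0%R, +oo[) (F r)%:E)%E.
Proof.
move=> q0 F0 Fmono mF.
have jq0 (j : nat) : 0 <= j%:R * q by rewrite mulr_ge0// ltW.
have mFE (D : set R) : measurable D -> D `<=` `[0, +oo[ ->
    measurable_fun D (fun r => (F r)%:E).
  by move=> mD DR; apply/measurable_EFinP; apply: measurable_funS mF.
have sub0 (j : nat) (b : R) : `[j%:R * q, b[ `<=` `[0%R, +oo[.
  by move=> r /=; rewrite !in_itv/= andbT => /andP[+ _]; exact: le_trans.
apply: (@le_trans _ _
  (\int[lebesgue_measure]_(r in `[(0%:R * q)%R, (n%:R * q)%R[) (F r)%:E)%E); last first.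
  apply: ge0_subset_integral => //; first exact: mFE.
  by move=> r /=; rewrite in_itv/= andbT lee_fin; exact: F0.
elim: n => [|n IHn].
  by rewrite big_ord0 set_itv_ge ?integral_set0// -leNgt bnd_simp.
have split_itv : `[0%:R * q, n.+1%:R * q[%classic =
    `[0%:R * q, n%:R * q[ `|` `[n%:R * q, n.+1%:R * q[ :> set R.
  by rewrite -itv_bndbnd_setU// bnd_simp ?(mul0r,mulr0n)// ler_pM2r// ler_nat.
rewrite split_itv ge0_integral_setU//=; last 3 first.
- apply: mFE; first exact: measurableU.
  by move=> r [/(sub0 0%N)|/sub0].
- move=> r rU; rewrite lee_fin F0//.
  by case: rU => [/(sub0 0%N)|/sub0] /=; rewrite in_itv/= andbT.
- rewrite disj_set2E; apply/eqP; rewrite -subset0 => r [] /=.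
  by rewrite !in_itv/= => /andP[_ h1] /andP[]; rewrite leNgt h1.
rewrite big_ord_recr/= EFinD leeD//.
have -> : (q * F (n.+1%:R * q))%:E =
   (\int[lebesgue_measure]_(r in `[(n%:R * q)%R, (n.+1%:R * q)%R[) (F (n.+1%:R * q))%:E)%E.
  rewrite integral_cst//= lebesgue_measure_itv/= lte_fin ltr_pM2r// ltr_nat ltnSn.
  by rewrite -EFinB -EFinM -mulrBl -natrB// subSnn mul1r mulrC.
apply: ge0_le_integral => //.
- by move=> r _; rewrite lee_fin F0.
- exact: mFE.
- move=> r /=; rewrite in_itv/= => /andP[h1 h2].
  by rewrite lee_fin; apply: Fmono; [exact: le_trans h1|exact: ltW].
Qed.

Section Damping.
Context {R : realType}.
Variables (kappa : R) (S : R -> R) (q : R).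
Hypotheses (pS : profile_properties kappa S) (q01 : 0 < q < 1).

Let q0 : 0 < q. Proof. by case/andP: q01. Qed.
Let q1 : q < 1. Proof. by case/andP: q01. Qed.

(** This is sqrt mu * theta_(n+1): the rescaled coefficient increases from q to
    1, and the index shift makes it start at n = 0. *)
Definition damping (n : nat) : R := q + (1 - q) * S (n%:R * q).
Local Notation T := damping.

Let nq0 (n : nat) : 0 <= n%:R * q. Proof. by rewrite mulr_ge0// ltW. Qed.

Let S01 (n : nat) : 0 <= S (n%:R * q) < 1. Proof. exact: (profile_range pS). Qed.

Lemma damping_bounds n : q <= T n < 1.
Proof.
rewrite /T; have /andP[a b] := S01 n.
have q1' : 0 < 1 - q by rewrite subr_gt0.
by apply/andP; split; nra.
Qed.

(** The increment of T is (1 - q) q S'(c) <= (1 - q) q (1 - S(n q)^2) / 2: it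
    suffices to bound S' at the mean value point c through
    2 S' <= 1 - S^2, as S c >= S (n q). *)
Lemma damping_growth n :
  T n.+1 ^+ 2 - q * T n.+1 <= (1 - q * T n.+1) * T n ^+ 2.
Proof.
have dS (r : R) : 0 <= r -> is_derive r 1 S (derive1 S r).
  move=> r0; apply: DeriveDef; first exact: (profile_derivable pS).
  by rewrite derive1E.
have nn : n%:R * q <= n.+1%:R * q by rewrite ler_pM2r// ler_nat.
have [c /andP[nc cn] E] := MVT_ray (nq0 n) nn dS.
have c0 := le_trans (nq0 n) nc.
have /andP[_ dSc] := profile_ineq pS c0.
have S_le : S (n%:R * q) <= S c.
  by apply: (profile_nondecreasing pS) => //; rewrite in_itv/= ?andbT.
have /andP[a0 a1] := S01 n.
have T_incr : T n.+1 - T n = (1 - q) * q * derive1 S c.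
  have -> : T n.+1 - T n = (1 - q) * (S (n.+1%:R * q) - S (n%:R * q)).
    by rewrite /T; ring.
  by rewrite E -mulrBl -natrB// subSnn mul1r; ring.
have /andP[qT T1] := damping_bounds n.+1.
have T_mono : T n <= T n.+1.
  rewrite lerD2l ler_pM2l ?subr_gt0//; apply: (profile_nondecreasing pS);
    by rewrite ?in_itv/= ?andbT.
have dS_le : 2 * derive1 S c <= 1 - S (n%:R * q) ^+ 2.
  have : S (n%:R * q) ^+ 2 <= S c ^+ 2.
    by rewrite ler_pXn2r ?nnegrE// (le_trans a0).
  by move: dSc; lra.
have incr_le : 2 * (T n.+1 - T n) <= q * (1 - T n ^+ 2).
  have -> : 1 - T n ^+ 2 = (1 - q) * (1 - S (n%:R * q) ^+ 2)
      + q * (1 - q) * (1 - S (n%:R * q)) ^+ 2 by rewrite /T; ring.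
  rewrite T_incr mulrDr -[leLHS]addr0; apply: lerD.
    have -> : 2 * ((1 - q) * q * derive1 S c) = q * (1 - q) * (2 * derive1 S c) by ring.
    by rewrite [leRHS]mulrA ler_wpM2l// mulr_ge0 ?subr_ge0 ?ltW.
  by rewrite !mulr_ge0 ?sqr_ge0 ?subr_ge0// ltW.
have T'0 : 0 <= T n.+1 by apply: le_trans qT; exact: ltW.
have := ler_wpM2r T'0 incr_le.
have : (T n.+1 - T n) * (T n.+1 + T n) <= (T n.+1 - T n) * (2 * T n.+1).
  by rewrite ler_wpM2l ?subr_ge0// mulr_natl mulr2n lerD2l.
move: (T n) (T n.+1) => x y; lra.
Qed.

(** Each factor exceeds 1 - q only by the relative amount q (1 - S(j q)), and
    these amounts are summable; 1 + u <= exp u turns the product into the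
    exponential of a bounded sum. *)
Lemma prod_damping_le : exists2 C : R, 0 < C &
  forall n, \prod_(j < n) (1 - q * T j.+1) <= C * (1 - q) ^+ n.
Proof.
have S_mono (r t : R) : 0 <= r -> r <= t -> S r <= S t.
  move=> r0 rt; apply: (profile_nondecreasing pS) => //; rewrite in_itv/= ?andbT//.
  exact: le_trans rt.
have sum_le n := @sum_le_integral R (fun r => 1 - S r) q n q0.
set I := (\int[lebesgue_measure]_(r in `[0%R, +oo[) (1 - S r)%:E)%E in sum_le.
have I_fin : I \is a fin_num.
  rewrite ge0_fin_numE; first exact: (profile_integral pS).
  apply: integral_ge0 => r /=; rewrite in_itv/= andbT => /(profile_range pS) h.
  by rewrite lee_fin; move: h; lra.
have {}sum_le n : \sum_(j < n) q * (1 - S (j.+1%:R * q)) <= fine I.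
  rewrite -lee_fin fineK//; apply: sum_le.
  - by move=> r /(profile_range pS); lra.
  - by move=> r t r0 rt; rewrite lerD2l lerN2 S_mono.
  - apply: subspace_continuous_measurable_fun => //.
    apply: derivable_within_continuous => r; rewrite in_itv/= andbT => r0.
    by apply: derivableB => //; exact: (profile_derivable pS).
exists (expR (fine I)); first exact: expR_gt0.
move=> n; rewrite mulrC.
have -> : \prod_(j < n) (1 - q * T j.+1) =
    (1 - q) ^+ n * \prod_(j < n) (1 + q * (1 - S (j.+1%:R * q))).
  rewrite -[in X in X * _](card_ord n) -prodr_const -big_split/=.
  by apply: eq_bigr => j _; rewrite /T; ring.
rewrite ler_pM2l ?exprn_gt0 ?subr_gt0//.
apply: le_trans (_ : expR (\sum_(j < n) q * (1 - S (j.+1%:R * q))) <= _);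
  last by rewrite ler_expR.
rewrite expR_sum; apply: ler_prod => j _; rewrite expR_ge1Dx andbT.
have /andP[_ /ltW s1] := S01 j.+1.
by rewrite addr_ge0// mulr_ge0 ?subr_ge0// ltW.
Qed.

End Damping.

(** * Inner products, convexity and the proximal map *)

(** A symmetric bilinear form on a real space that induces the given norm,
    written as laws of a plain function so that its values have type R on the
    nose. *)
Record inner_product {R : realType} {H : completeNormedModType R}
    (ip : H -> H -> R) : Prop := InnerProduct {
  ipC : forall u v, ip u v = ip v u;
  ipDr : forall u v w, ip u (v + w) = ip u v + ip u w;
  ipZr : forall u (t : R) v, ip u (t *: v) = t * ip u v;
  sqr_normE : forall u, `|u| ^+ 2 = ip u u
}.

Lemma dot_inner_product {R : realType} {H : completeNormedModType R}
    (ip : {dot H for idfun}) :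
  (forall x : H, `|x| = Num.sqrt (ip x x)) -> inner_product ip.
Proof.
move=> ip_norm.
have ipC u v : ip u v = ip v u by have := hermC ip u v; rewrite expr0 mul1r.
split=> //.
- by move=> u v w; exact: linearDr.
- by move=> u t v; exact: linearZr_LR.
- move=> x; rewrite ip_norm sqr_sqrtr//; have [->|x0] := eqVneq x 0.
    by rewrite linear0r.
  exact/ltW/neq0_dnorm_gt0.
Qed.

Section InnerProduct.
Context {R : realType} {H : completeNormedModType R}.
Variable ip : H -> H -> R.
Hypothesis ipP : inner_product ip.
Implicit Types u v w x y : H.

Lemma ipNr u v : ip u (- v) = - ip u v.
Proof. by rewrite -scaleN1r (ipZr ipP) mulN1r. Qed.

Lemma ipDl u v w : ip (v + w) u = ip v u + ip w u.
Proof. by rewrite (ipC ipP) (ipDr ipP) !(ipC ipP u). Qed.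

Lemma ipNl u v : ip (- v) u = - ip v u.
Proof. by rewrite (ipC ipP) ipNr (ipC ipP u). Qed.

Lemma ipZl u (t : R) v : ip (t *: v) u = t * ip v u.
Proof. by rewrite (ipC ipP) (ipZr ipP) (ipC ipP u). Qed.

Definition ipE := (ipDr ipP, ipDl, ipNr, ipNl, ipZr ipP, ipZl).

(** Squaring the triangle inequality for u + v. *)
Lemma cauchy_schwarz u v : ip u v <= `|u| * `|v|.
Proof.
have : `|u + v| ^+ 2 <= (`|u| + `|v|) ^+ 2.
  by rewrite ler_pXn2r ?nnegrE ?addr_ge0 ?ler_normD.
rewrite sqrrD !(sqr_normE ipP) !ipE (ipC ipP v u); lra.
Qed.

(** The exact convexity defect of the squared norm; at t = 1/2 this is the
    parallelogram law. *)
Lemma sqr_norm_segment (t : R) x y u :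
  `|t *: x + (1 - t) *: y - u| ^+ 2 =
    t * `|x - u| ^+ 2 + (1 - t) * `|y - u| ^+ 2 - t * (1 - t) * `|x - y| ^+ 2.
Proof.
rewrite !(sqr_normE ipP) !ipE (ipC ipP y x) (ipC ipP u x) (ipC ipP u y); ring.
Qed.

End InnerProduct.

Section ConvexExtended.
Context {R : realType} {H : completeNormedModType R}.
Variable g : H -> \bar R.
Hypotheses (g_proper : forall x, g x != -oo%E) (g_convex : econvex g).

Lemma econvex_real (t : R) x y (a b : R) : 0 <= t <= 1 ->
  g x = a%:E -> g y = b%:E ->
  exists2 c : R, g (t *: x + (1 - t) *: y) = c%:E & c <= t * a + (1 - t) * b.
Proof.
move=> /andP[]; rewrite le_eqVlt => /predU1P[<- _|t0].
  by move=> _ gy; exists b; rewrite ?scale0r ?add0r ?subr0 ?scale1r// mul0r mul1r add0r.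
rewrite le_eqVlt => /predU1P[-> gx _|t1 gx gy].
  by exists a; rewrite subrr ?scale0r ?addr0 ?scale1r// mul0r mul1r addr0.
have t01 : 0 < t < 1 by rewrite t0.
have := g_convex x y t01; rewrite gx gy -!(@EFinM R) -(@EFinD R).
have := g_proper (t *: x + (1 - t) *: y).
by case: (g _) => //= c _; rewrite lee_fin => h; exists c.
Qed.

Lemma edomainP x : edomain g x -> exists c : R, g x = c%:E.
Proof. by rewrite /edomain/=; have := g_proper x; case: (g x) => // c _ _; exists c. Qed.

End ConvexExtended.

Section Prox.
Context {R : realType} {H : completeNormedModType R}.
Variable ip : H -> H -> R.
Hypothesis ipP : inner_product ip.
Variable g : H -> \bar R.
Hypotheses (g_proper : proper_efun g) (g_lsc : lower_semicontinuous g).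
Hypothesis g_convex : econvex g.
Variables (w0 : H) (c0 : R).
Hypothesis g_minorant : forall v (a : R), g v = a%:E -> ip w0 v + c0 <= a.
Implicit Types (u v w x y : H) (lambda : R).

Let g_ninfty := proj1 g_proper.

(** The affine minorant of g makes the objective bounded below.  Comparing two
    almost minimal points with their midpoint bounds their distance, so a
    minimizing sequence converges, and lower semicontinuity passes to the
    limit. *)
Lemma argmin_prox_neq0 (c : R) u : 0 < c ->
  argmin (fun v => g v + (c * `|v - u| ^+ 2)%:E)%E !=set0.
Proof.
move=> c_gt0; set F := fun v => _.
have [x0 x0dom] := proj2 g_proper.
pose B : R := ip w0 u + c0 - `|w0| ^+ 2 / (4 * c).
have F_bounded v : (B%:E <= F v)%E.
  rewrite /F; have := g_ninfty v; case gv : (g v) => [a||] // _; last first.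
    by rewrite addye// leey.
  rewrite -(@EFinD R) lee_fin; apply: le_trans (lerD (g_minorant gv) (lexx _)).
  rewrite /B.
  have -> : ip w0 v = ip w0 u + ip w0 (v - u) by rewrite !(ipE ipP); ring.
  have := cauchy_schwarz ipP (- w0) (v - u); rewrite normrN !(ipE ipP).
  set d := `|v - u|; set n := `|w0| => CS.
  (* Completing the square in the distance to u. *)
  have : 0 <= c * (d - n / (2 * c)) ^+ 2 by rewrite mulr_ge0 ?sqr_ge0 ?ltW.
  have -> : c * (d - n / (2 * c)) ^+ 2 = c * d ^+ 2 - n * d + n ^+ 2 / (4 * c).
    by field; rewrite gt_eqF.
  by move: CS; lra.
set m := ereal_inf (range F).
have m_fin : m \is a fin_num.
  rewrite fin_numE; apply/andP; split.
    rewrite -ltNye; apply: lt_le_trans (_ : (_%:E <= m)%E); last first.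
      by apply: le_ereal_inf_tmp => _ [v _ <-]; exact: F_bounded.
    exact: ltNyr.
  rewrite -ltey; apply: (@le_lt_trans _ _ (F x0)); first by apply: ereal_inf_lbound; exists x0.
  have [r gr] := edomainP g_ninfty x0dom.
  by rewrite /F gr -(@EFinD R) ltry.
have m_le v : (m <= F v)%E by apply: ereal_inf_lbound; exists v.
have near_min (n : nat) : exists v, exists2 a : R, g v = a%:E &
    a + c * `|v - u| ^+ 2 <= fine m + n.+1%:R^-1.
  have n0 : 0 < n.+1%:R^-1 :> R by rewrite invr_gt0 ltr0n.
  have [_ [v _ <-]] := lb_ereal_inf_adherent n0 m_fin.
  rewrite -/m -(fineK m_fin) /F -(@EFinD R).
  have := g_ninfty v; case gv : (g v) => [a||] //= _.
  by rewrite -(@EFinD R) lte_fin => /ltW lt; exists v, a.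
have [v hv] := choice near_min.
(* The midpoint of two almost minimal points cannot go below the infimum, which
   bounds the parallelogram defect c / 4 * |v i - v j|^2. *)
have close (i j N : nat) : (N <= i)%N -> (N <= j)%N ->
    `|v i - v j| ^+ 2 <= 4 / c * N.+1%:R^-1.
  move=> Ni Nj; have [a ga ha] := hv i; have [b gb hb] := hv j.
  have half : 0 <= (2^-1 : R) <= 1 by apply/andP; split; lra.
  have [e ge he] := econvex_real g_ninfty g_convex half ga gb.
  have := m_le (2^-1 *: v i + (1 - 2^-1) *: v j).
  rewrite /F ge -(@EFinD R) -(fineK m_fin) lee_fin (sqr_norm_segment ipP).
  have inv_le (k : nat) : (N <= k)%N -> k.+1%:R^-1 <= N.+1%:R^-1 :> R.
    by move=> Nk; rewrite lef_pV2 ?posrE ?ltr0n// ler_nat ltnS.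
  have := inv_le _ Ni; have := inv_le _ Nj.
  move=> hi hj mid; rewrite [leRHS]mulrAC ler_pdivlMr//.
  move: ha hb he hi hj mid.
  move: (fine m) (`|v i - u| ^+ 2) (`|v j - u| ^+ 2) (`|v i - v j| ^+ 2) => M A A2 D.
  move: (N.+1%:R^-1) (i.+1%:R^-1) (j.+1%:R^-1) => n1 n2 n3; lra.
have v_cauchy : cauchy (v @ \oo).
  apply/cauchyP => e e0; have : 0 < e ^+ 2 * c / 4 by rewrite !mulr_gt0 ?exprn_gt0.
  move=> /ltr_add_invr[N]; rewrite add0r => hN; exists (v N).
  exists N => // n /= Nn; rewrite -ball_normE /=.
  rewrite -(ltr_pXn2r (n := 2)) ?nnegrE ?(ltW e0)//.
  apply: le_lt_trans (close N n N (leqnn _) Nn) _.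
  by rewrite [ltLHS]mulrAC ltr_pdivrMr// mulrC -ltr_pdivlMr//.
have v_cvg : v @ \oo --> lim (v @ \oo) by exact: cauchy_cvg.
set q := lim _ in v_cvg; exists q => w; apply: le_trans (m_le w).
rewrite leNgt; apply/negP => m_lt.
pose K : R := c * `|q - u| ^+ 2.
(* A real level below g q but above what the minimizing sequence allows: lower
   semicontinuity keeps g above it near q. *)
have [a a_gt a_lt] : exists2 a : R, fine m - K < a & (a%:E < g q)%E.
  move: m_lt; rewrite -(fineK m_fin) /F; have := g_ninfty q.
  case: (g q) => [b||] // _.
    rewrite -(@EFinD R) lte_fin -/K => m_lt.
    by exists ((fine m - K + b) / 2); rewrite ?lte_fin; lra.
  by exists (fine m - K + 1); rewrite ?ltry//; lra.
have [V Vq Va] := g_lsc a_lt.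
have : a + K <= fine m.
  have cvg_val : (fun n => a + c * (`|v n - u| * `|v n - u|) - n.+1%:R^-1)
      @ \oo --> a + c * (`|q - u| * `|q - u|) - 0.
    have n1 : (fun n => `|v n - u|) @ \oo --> `|q - u|.
      by apply: cvg_norm; apply: cvgB => //; exact: cvg_cst.
    apply: cvgB; last exact: cvg_harmonic.
    by apply: cvgD; [exact: cvg_cst|apply: cvgMr; exact: cvgM].
  rewrite /K expr2 -[X in X <= _]subr0; apply: (cvgr_to_le cvg_val).
  near=> n; have /Va : V (v n) by near: n; exact: v_cvg.
  have [b -> hb] := hv n; rewrite lte_fin -expr2 lerBlDr => ab.
  by apply: le_trans hb; rewrite lerD2r ltW.
by move: a_gt; lra.
Unshelve. all: by end_near. Qed.

Lemma prox_argmin lambda u : 0 < lambda ->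
  argmin (fun v => g v + ((2 * lambda)^-1 * `|v - u| ^+ 2)%:E)%E (prox lambda g u).
Proof.
move=> l0; rewrite /prox; case: xgetP => // /(_ _)none.
have c_gt0 : 0 < (2 * lambda)^-1 by rewrite invr_gt0 mulr_gt0.
by have [v hv] := argmin_prox_neq0 u c_gt0; case: (none v).
Qed.

Lemma prox_real lambda u : 0 < lambda -> exists a : R, g (prox lambda g u) = a%:E.
Proof.
move=> l0; have [x xdom] := proj2 g_proper.
have [b gb] := edomainP g_ninfty xdom.
have := prox_argmin u l0 x; rewrite gb -(@EFinD R).
have := g_ninfty (prox lambda g u); case: (g _) => //= a _ _; by exists a.
Qed.

(** Minimality is tested along the segment from the proximal point to w; the
    first order in t is the inequality, the second order vanishes with t. *)
Lemma prox_le lambda u w (a b : R) : 0 < lambda ->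
  g (prox lambda g u) = a%:E -> g w = b%:E ->
  a <= b + lambda^-1 * ip (u - prox lambda g u) (prox lambda g u - w).
Proof.
move=> l0; have := prox_argmin u l0; set x := prox _ _ _ => x_min gx gw.
set c := ip _ _.
have le_t (t : R) : 0 < t < 1 ->
    a - b - lambda^-1 * c <= t * ((2 * lambda)^-1 * `|w - x| ^+ 2).
  move=> /andP[t0 t1]; have t01 : 0 <= t <= 1 by rewrite !ltW.
  have [e ge he] := econvex_real g_ninfty g_convex t01 gw gx.
  have := x_min (t *: w + (1 - t) *: x).
  rewrite ge gx -!(@EFinD R) lee_fin (sqr_norm_segment ipP).
  have -> : `|w - u| ^+ 2 = `|w - x| ^+ 2 + `|x - u| ^+ 2 + 2 * c.
    rewrite /c !(sqr_normE ipP) !(ipE ipP) (ipC ipP x w) (ipC ipP u w) (ipC ipP u x).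
    by ring.
  move: (`|w - x| ^+ 2) (`|x - u| ^+ 2) => A B h.
  rewrite -(ler_pM2l t0); move: h he.
  have -> : (2 * lambda)^-1 = lambda^-1 / 2 by rewrite invfM mulrC.
  nra.
have lim0 : (fun t => t * ((2 * lambda)^-1 * `|w - x| ^+ 2)) @ 0^'+ -->
    0 * ((2 * lambda)^-1 * `|w - x| ^+ 2).
  by apply: cvgMl; apply: cvg_at_right_filter; exact: cvg_id.
suff : a - b - lambda^-1 * c <= 0 by lra.
rewrite -[leRHS](mul0r ((2 * lambda)^-1 * `|w - x| ^+ 2)).
apply: (cvgr_to_ge lim0); near=> t; apply: le_t; apply/andP; split; near: t.
- exact: nbhs_right_gt.
- exact: nbhs_right_lt.
Unshelve. all: by end_near. Qed.

End Prox.

(** * One accelerated forward-backward step *)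

(** The step of the two-sequence scheme starts from (1 - b) z + b y, and y is
    the combination of x and z that is itself the average of x and of this
    starting point: an averaged iterate (1 - a) x + a z' then differs from y by
    a times the move of z. *)
Lemma averaged_extrapolation {R : realType} {V : lmodType R} (a b : R) (x y z : V) :
  (1 - a * b) *: y = (1 - a) *: x + (a - a * b) *: z ->
  y = (1 - a) *: x + a *: ((1 - b) *: z + b *: y).
Proof.
move=> yE; have {1}-> : y = (1 - a * b) *: y + (a * b) *: y.
  by rewrite -scalerDl subrK scale1r.
by rewrite yE scalerDr !scalerA mulrBr mulr1 addrA.
Qed.

Section StepInequality.
Context {R : realType} {H : completeNormedModType R}.
Variable ip : H -> H -> R.
Hypothesis ipP : inner_product ip.
Variables (f : H -> R) (G : H -> H) (mu L : R).
Hypotheses (mu_gt0 : 0 < mu) (L_gt0 : 0 < L).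
Hypothesis f_sc : forall x y,
  f x + ip (G x) (y - x) + mu / 2 * `|y - x| ^+ 2 <= f y.
Hypothesis G_lip : forall x y, `|G x - G y| <= L * `|x - y|.
Implicit Types u v w x y z : H.

(** Convexity between x and x + d gives the constant L instead of L / 2.
    Passing through the midpoint turns a constant C into C / 2 + L / 4, an
    iteration with fixed point L / 2. *)
Lemma descent_halving n x d :
  f (x + d) <= f x + ip (G x) d + (L / 2 + L / 2 ^+ n.+1) * `|d| ^+ 2.
Proof.
elim: n x d => [|n IHn] x d.
  have := f_sc (x + d) x; have -> : x - (x + d) = - d by rewrite opprD addrA subrr sub0r.
  rewrite normrN (ipNr ipP) => sc.
  have mu0 : 0 <= mu / 2 * `|d| ^+ 2 by rewrite mulr_ge0 ?sqr_ge0// divr_ge0 ?ltW.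
  have CS := cauchy_schwarz ipP (G (x + d) - G x) d.
  have : `|G (x + d) - G x| * `|d| <= L * `|d| * `|d|.
    rewrite ler_wpM2r//; apply: le_trans (G_lip _ _) _.
    by rewrite addrAC subrr add0r.
  have -> : L / 2 + L / 2 ^+ 1 = L by field.
  by move: CS; rewrite (ipDl ipP) (ipNl ipP); lra.
pose h : H := 2^-1 *: d.
have dE : d = h + h.
  by rewrite -scalerDl (_ : 2^-1 + 2^-1 = 1) ?scale1r//; field.
have h1 := IHn (x + h) h.
have h0 := IHn x h.
have CS := cauchy_schwarz ipP (G (x + h) - G x) h.
have Lh : `|G (x + h) - G x| * `|h| <= L * `|h| * `|h|.
  rewrite ler_wpM2r//; apply: le_trans (G_lip _ _) _.
  by rewrite addrAC subrr add0r.
rewrite {1}dE addrA; apply: (le_trans h1).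
have -> : `|d| ^+ 2 = 4 * `|h| ^+ 2.
  by rewrite dE !(sqr_normE ipP) !(ipE ipP); ring.
have -> : ip (G x) d = ip (G x) h + ip (G x) h by rewrite dE (ipDr ipP).
move: CS; rewrite (ipDl ipP) (ipNl ipP).
have -> : L / 2 ^+ n.+2 = L / 2 ^+ n.+1 / 2 by rewrite exprSr invfM mulrA.
move: h0 Lh; rewrite -mulrA -expr2; lra.
Qed.

Lemma descent x y : f y <= f x + ip (G x) (y - x) + L / 2 * `|y - x| ^+ 2.
Proof.
have yE : y = x + (y - x) by rewrite addrCA subrr addr0.
set d := y - x in yE *; rewrite yE.
have lim_half : (fun n => f x + ip (G x) d + (L / 2 + L * geometric 2^-1 2^-1 n) * `|d| ^+ 2)
    @ \oo --> f x + ip (G x) d + (L / 2 + L * 0) * `|d| ^+ 2.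
  apply: cvgD; first exact: cvg_cst.
  apply: cvgMl; apply: cvgD; first exact: cvg_cst.
  apply: cvgMr; apply: cvg_geometric.
  by rewrite ger0_norm ?invr_ge0// invf_lt1// ltr1n.
rewrite -[L / 2]addr0 -[X in L / 2 + X](mulr0 L).
apply: (cvgr_to_ge lim_half); near=> n.
have := descent_halving n x d.
by rewrite /geometric /= -exprS exprVn.
Unshelve. all: by end_near. Qed.

Variables (g : H -> \bar R) (xs : H) (gs : R).
Hypotheses (g_proper : proper_efun g) (g_convex : econvex g).
Hypothesis g_xs : g xs = gs%:E.
Hypothesis xs_min : forall v (a : R), g v = a%:E -> f xs + gs <= f v + a.

Let g_ninfty := proj1 g_proper.

(** Fermat's rule: minus the gradient of f at a minimizer of f + g is a
    subgradient of g. *)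
Lemma minimizer_minorant v (a : R) : g v = a%:E ->
  ip (- G xs) v + (gs + ip (G xs) xs) <= a.
Proof.
move=> gv; have le_t (t : R) : 0 < t < 1 ->
    gs - a - ip (G xs) (v - xs) <= t * (L / 2 * `|v - xs| ^+ 2).
  move=> /andP[t0 t1]; have t01 : 0 <= t <= 1 by rewrite !ltW.
  have [e ge he] := econvex_real g_ninfty g_convex t01 gv g_xs.
  have := xs_min ge; set x := t *: v + _.
  have := descent xs x.
  have -> : x - xs = t *: (v - xs).
    by rewrite /x scalerBr scalerBl scale1r addrA addrAC addrK.
  rewrite normrZ exprMn (ipZr ipP) (ger0_norm (ltW t0)).
  move: (ip _ _) (`|_| ^+ 2) => c D h1 h2; rewrite -(ler_pM2l t0).
  by move: he h1 h2; lra.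
have lim0 : (fun t => t * (L / 2 * `|v - xs| ^+ 2)) @ 0^'+ -->
    0 * (L / 2 * `|v - xs| ^+ 2).
  by apply: cvgMl; apply: cvg_at_right_filter; exact: cvg_id.
have : gs - a - ip (G xs) (v - xs) <= 0.
  rewrite -[leRHS](mul0r (L / 2 * `|v - xs| ^+ 2)).
  apply: (cvgr_to_ge lim0); near=> t; apply: le_t; apply/andP; split; near: t.
  - exact: nbhs_right_gt.
  - exact: nbhs_right_lt.
by rewrite (ipNl ipP) (ipDr ipP) (ipNr ipP); lra.
Unshelve. all: by end_near. Qed.

Variables (s : R).
Hypothesis s_bd : 0 < s <= L^-1.

(** The last hypothesis is the form common to both proximal steps.  The
    gradient terms cancel because x', x and xs enter with total weight
    x' - (1 - a) x - a xs; the condition a b = s mu makes the term in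
    |y - xs|^2 produced by the convexity of the squared norm exactly the one
    gained from strong convexity. *)
Lemma accelerated_step (a b : R) x y z x' z' (gx gx' : R) :
  0 < a <= 1 -> 0 <= b <= 1 -> a * b = s * mu ->
  (1 - a * b) *: y = (1 - a) *: x + (a - a * b) *: z ->
  x' = (1 - a) *: x + a *: z' ->
  gx' <= (1 - a) * gx + a * gs
    + a ^+ 2 / s * ip ((1 - b) *: z + b *: y - z') (z' - xs)
    - ip (G y) (x' - (1 - a) *: x - a *: xs) ->
  f x' + gx' - (f xs + gs) + a ^+ 2 / (2 * s) * `|z' - xs| ^+ 2 <=
    (1 - a) * (f x + gx - (f xs + gs))
    + a ^+ 2 / (2 * s) * (1 - b) * `|z - xs| ^+ 2.
Proof.
move=> /andP[a0 a1] /andP[b0 b1] abE yE x'E prox_ineq.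
have /andP[s0 sL] := s_bd.
set v := (1 - b) *: z + b *: y in prox_ineq.
have yE' := averaged_extrapolation yE; rewrite -/v in yE'.
have x'y : x' - y = a *: (z' - v).
  by rewrite {1}yE' x'E opprD addrACA subrr add0r -scalerBr.
have dsc := descent y x'.
have scx := f_sc y x.
have scs := f_sc y xs.
have L_le : L / 2 * `|x' - y| ^+ 2 <= a ^+ 2 / (2 * s) * `|z' - v| ^+ 2.
  rewrite x'y normrZ exprMn (ger0_norm (ltW a0)).
  have -> : a ^+ 2 / (2 * s) * `|z' - v| ^+ 2 = s^-1 / 2 * (a ^+ 2 * `|z' - v| ^+ 2).
    by field; rewrite gt_eqF.
  rewrite ler_wpM2r//; first by rewrite mulr_ge0 ?sqr_ge0.
  by rewrite ler_wpM2r// -(invrK L) lef_pV2 ?posrE ?invr_gt0.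
have sqv : `|v - xs| ^+ 2 <= (1 - b) * `|z - xs| ^+ 2 + b * `|y - xs| ^+ 2.
  have -> : v = b *: y + (1 - b) *: z by rewrite addrC.
  rewrite (sqr_norm_segment ipP).
  have : 0 <= b * (1 - b) * `|y - z| ^+ 2.
    by rewrite !mulr_ge0 ?sqr_ge0 ?subr_ge0.
  lra.
have three w : ip (w - z') (z' - xs) =
    (`|w - xs| ^+ 2 - `|z' - xs| ^+ 2 - `|z' - w| ^+ 2) / 2.
  rewrite !(sqr_normE ipP) !(ipE ipP) (ipC ipP z' w) (ipC ipP xs z') (ipC ipP xs w).
  by field.
have lin : ip (G y) (x' - y) - (1 - a) * ip (G y) (x - y) - a * ip (G y) (xs - y)
    - ip (G y) (x' - (1 - a) *: x - a *: xs) = 0.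
  by rewrite !(ipE ipP); ring.
(* The coefficient of the distance terms; c b = a mu / 2 is where the relation
   a b = s mu enters. *)
pose c := a ^+ 2 / (2 * s).
have c0 : 0 <= c by rewrite divr_ge0 ?sqr_ge0// mulr_ge0// ltW.
have cE : a ^+ 2 / s = c * 2 by rewrite /c; field; rewrite gt_eqF.
have cb : c * b = a * (mu / 2).
  have -> : c * b = a * (a * b) / (2 * s) by rewrite /c; ring.
  by rewrite abE; field; rewrite gt_eqF.
rewrite -/c cE in prox_ineq L_le *.
have sqv' := ler_wpM2l c0 sqv.
have a1' : 0 <= 1 - a by rewrite subr_ge0.
have scx' := ler_wpM2l a1' scx.
have scs' := ler_wpM2l (ltW a0) scs.
have mux : 0 <= (1 - a) * (mu / 2 * `|x - y| ^+ 2).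
  by rewrite !mulr_ge0 ?sqr_ge0 ?subr_ge0 ?divr_ge0// ltW.
have cb' : c * (b * `|y - xs| ^+ 2) = a * (mu / 2 * `|xs - y| ^+ 2).
  by rewrite mulrA cb -mulrA (distrC xs).
rewrite three in prox_ineq.
move: prox_ineq dsc scx' scs' L_le sqv' mux cb' lin.
move: (`|v - xs| ^+ 2) (`|z' - xs| ^+ 2) (`|z' - v| ^+ 2) (`|z - xs| ^+ 2)
  (`|y - xs| ^+ 2) (`|x - y| ^+ 2) (`|xs - y| ^+ 2) (`|x' - y| ^+ 2) =>
  n1 n2 n3 n4 n5 n6 n7 n8.
move: (ip (G y) (x' - y)) (ip (G y) (x - y)) (ip (G y) (xs - y)) (ip (G y) _)
  => i1 i2 i3 i4.
move: (f x) (f x') (f y) (f xs) => f1 f2 f3 f4.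
lra.
Qed.

End StepInequality.

(** * Coefficients of the schemes *)

Section Coefficients.
Context {R : realType}.
Variables (kappa : R) (S : R -> R) (s mu : R).
Hypotheses (pS : profile_properties kappa S) (s_gt0 : 0 < s) (mu_gt0 : 0 < mu).
Local Notation q := (Num.sqrt (s * mu)).
Local Notation T := (damping S q).
Hypothesis q_lt1 : q < 1.

Lemma sqrt_coeff_gt0 : 0 < q. Proof. by rewrite sqrtr_gt0 mulr_gt0. Qed.

Let q01 : 0 < q < 1. Proof. by rewrite sqrt_coeff_gt0. Qed.

Lemma damping_gt0 n : 0 < T n.
Proof. by have /andP[+ _] := damping_bounds pS q01 n; exact: lt_le_trans sqrt_coeff_gt0. Qed.

Lemma thetaE n : theta S s mu n.+1 = T n / Num.sqrt mu.
Proof. by rewrite /theta mulrC. Qed.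

Let m_neq0 : Num.sqrt mu != 0. Proof. by rewrite gt_eqF// sqrtr_gt0. Qed.
Let T_neq0 n : T n != 0. Proof. by rewrite gt_eqF// damping_gt0. Qed.

Let qE : q = Num.sqrt s * Num.sqrt mu. Proof. by rewrite sqrtrM// ltW. Qed.

Let sqr_sqrt_mu : Num.sqrt mu ^+ 2 = mu. Proof. by rewrite sqr_sqrtr// ltW. Qed.
Let sqr_sqrt_s : Num.sqrt s ^+ 2 = s. Proof. by rewrite sqr_sqrtr// ltW. Qed.

Lemma averaging_coeffE n : Num.sqrt s / theta S s mu n.+1 = q / T n.
Proof.
rewrite thetaE; move: (T n) (T_neq0 n) => t t0.
by rewrite qE; field; rewrite t0 m_neq0.
Qed.

Lemma prox_stepE n : Num.sqrt s * theta S s mu n.+1 = s * T n / q.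
Proof.
rewrite thetaE; move: (T n) => t; rewrite qE -{2}sqr_sqrt_s; field.
by rewrite m_neq0 gt_eqF// sqrtr_gt0.
Qed.

Lemma damping_coeffE n : mu * (Num.sqrt s * theta S s mu n.+1) = q * T n.
Proof.
by rewrite thetaE; move: (T n) => t; rewrite qE -{1}sqr_sqrt_mu; field.
Qed.

Lemma betaE n : beta S s mu n.+1 =
  (T n - q) * (1 - q * T n.+1) / ((1 - q ^+ 2) * T n.+1).
Proof.
have q2 : 1 - q ^+ 2 != 0.
  by rewrite subr_eq0 eq_sym lt_eqF// exprn_ilt1// ltW// sqrt_coeff_gt0.
have smuE : 1 - s * mu = 1 - q ^+ 2 by rewrite sqr_sqrtr// mulr_ge0// ltW.
have -> : beta S s mu n.+1 = (theta S s mu n.+1 - Num.sqrt s) *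
   (1 - mu * (Num.sqrt s * theta S s mu n.+2)) / ((1 - s * mu) * theta S s mu n.+2).
  by rewrite mulrA.
rewrite damping_coeffE !thetaE smuE.
have -> : T n / Num.sqrt mu - Num.sqrt s = (T n - q) / Num.sqrt mu.
  by move: (T n) => t; rewrite qE; field.
by field; rewrite m_neq0 q2 T_neq0.
Qed.

(** Since z - x1 = (T_n / q - 1) (x1 - x0), any combination of x1 and z is an
    extrapolation from x0 through x1; beta is the coefficient that comes from
    the combination required by the accelerated step. *)
Lemma extrapolation_mix {H : completeNormedModType R} n (x0 x1 z : H) :
  x1 = (1 - q / T n) *: x0 + (q / T n) *: z ->
  (1 - s * mu) *: (x1 + beta S s mu n.+1 *: (x1 - x0)) =
    (1 - q / T n.+1) *: x1 + (q / T n.+1 - s * mu) *: z.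
Proof.
move=> x1E; have q_neq0 : q != 0 by rewrite gt_eqF// sqrt_coeff_gt0.
have q2 : 1 - q ^+ 2 != 0.
  by rewrite subr_eq0 eq_sym lt_eqF// exprn_ilt1// ltW// sqrt_coeff_gt0.
have smuE : 1 - s * mu = 1 - q ^+ 2 by rewrite sqr_sqrtr// mulr_ge0// ltW.
have zE : z = x1 + (T n / q - 1) *: (x1 - x0).
  have x1E' : x1 = x0 + (q / T n) *: (z - x0).
    by rewrite x1E scalerBl scale1r scalerBr addrA addrAC.
  rewrite {2}x1E' [x0 + _]addrC addrK {1}x1E' scalerA -addrA -scalerDl.
  have -> : q / T n + (T n / q - 1) * (q / T n) = 1.
    by field; rewrite T_neq0 q_neq0.
  by rewrite scale1r addrCA subrr addr0.
rewrite zE; move: (x1 - x0) => d.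
rewrite !scalerDr !scalerA addrA -scalerDl.
congr (_ *: _ + _ *: _); first ring.
have -> : q / T n.+1 - s * mu = q / T n.+1 - q ^+ 2.
  by rewrite sqr_sqrtr// mulr_ge0// ltW.
rewrite smuE betaE.
by field; rewrite q2 q_neq0 !T_neq0.
Qed.

Lemma damping_cvg : T n @[n --> \oo] --> (1 : R).
Proof.
have nq_oo : n%:R * q @[n --> \oo] --> +oo.
  exact: (cvg_comp _ _ cvgr_idn (gt0_cvgMly sqrt_coeff_gt0 (@cvg_id _ _))).
rewrite -[X in _ --> X](subrK q 1) addrC -[X in _ --> _ + X]mulr1.
apply: cvgD; first exact: cvg_cst.
by apply: cvgMr; exact: (cvg_comp _ _ nq_oo (profile_cvg pS)).
Qed.

Lemma beta_cvg_oo : beta S s mu k @[k --> \oo] --> (1 - q) / (1 + q).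
Proof.
rewrite -cvg_shiftS /=.
have Tc := damping_cvg.
have TcS : T n.+1 @[n --> \oo] --> (1 : R) by rewrite (cvg_shiftS T).
rewrite (_ : (1 - q) / (1 + q) =
    (1 - q) * (1 - q * 1) * ((1 - q ^+ 2) * 1)^-1); last first.
  rewrite !mulr1; have q0 := sqrt_coeff_gt0.
  have -> : 1 - q ^+ 2 = (1 - q) * (1 + q) by ring.
  by field; rewrite !gt_eqF// ?subr_gt0// ltr_pwDl.
under eq_fun do rewrite betaE.
apply: cvgM.
  apply: cvgM.
    by apply: cvgB => //; exact: cvg_cst.
  by apply: cvgB; [exact: cvg_cst|exact: cvgMr].
apply: cvgV; last exact: cvgMr.
by rewrite mulr1 subr_eq0 eq_sym lt_eqF// exprn_ilt1// ltW// sqrt_coeff_gt0.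
Qed.

End Coefficients.

(** * Decay of the energy *)

Section EnergyDecay.
Context {R : realType} {H : completeNormedModType R}.
Variable ip : H -> H -> R.
Hypothesis ipP : inner_product ip.
Variables (f : H -> R) (G : H -> H) (mu L s : R).
Hypotheses (mu_gt0 : 0 < mu) (L_gt0 : 0 < L).
Hypothesis f_sc : forall x y,
  f x + ip (G x) (y - x) + mu / 2 * `|y - x| ^+ 2 <= f y.
Hypothesis G_lip : forall x y, `|G x - G y| <= L * `|x - y|.
Hypothesis s_bd : 0 < s <= L^-1.
Variables (kappa : R) (S : R -> R).
Hypothesis pS : profile_properties kappa S.
Local Notation q := (Num.sqrt (s * mu)).
Local Notation T := (damping S q).
Hypothesis q_lt1 : q < 1.

Variables (xs : H) (gs : R) (x z : nat -> H) (gx : nat -> R).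
Hypothesis value_ge : forall n, f xs + gs <= f (x n.+1) + gx n.
Hypothesis average : forall n,
  x n.+1 = (1 - q / T n) *: x n + (q / T n) *: z n.+1.
Local Notation a_ n := (q / T n).
Local Notation b_ n := (q * T n).
Local Notation y_ n := (extrapolation S s mu x n).
Hypothesis prox_ineq : forall n,
  gx n.+1 <= (1 - a_ n.+1) * gx n + a_ n.+1 * gs
    + a_ n.+1 ^+ 2 / s * ip
        ((1 - b_ n.+1) *: z n.+1 + b_ n.+1 *: y_ n.+1 - z n.+2) (z n.+2 - xs)
    - ip (G (y_ n.+1)) (x n.+2 - (1 - a_ n.+1) *: x n.+1 - a_ n.+1 *: xs).

Let s_gt0 : 0 < s. Proof. by case/andP: s_bd. Qed.
Let q_gt0 : 0 < q. Proof. exact: sqrt_coeff_gt0. Qed.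
Let q01 : 0 < q < 1. Proof. by rewrite q_gt0. Qed.

Definition gap n : R := f (x n.+1) + gx n - (f xs + gs).

(** The usual Lyapunov function, normalized so that the distance term has
    weight 1: the inequality of one step multiplied by 2 T^2 / mu. *)
Definition energy n : R :=
  2 / mu * T n ^+ 2 * gap n + `|z n.+1 - xs| ^+ 2.

Lemma gap_ge0 n : 0 <= gap n.
Proof. by rewrite subr_ge0. Qed.

Lemma energy_contraction n : energy n.+1 <= (1 - q * T n.+1) * energy n.
Proof.
have T0 : 0 < T n.+1 by exact: damping_gt0 pS s_gt0 mu_gt0 q_lt1 _.
have /andP[qT T1] := damping_bounds pS q01 n.+1.
have a01 : 0 < q / T n.+1 <= 1 by rewrite divr_gt0//= ler_pdivrMr// mul1r.
have b01 : 0 <= q * T n.+1 <= 1.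
  rewrite mulr_ge0 ?(ltW q_gt0) ?(ltW T0)//=.
  by rewrite mulr_ile1 ?(ltW q_gt0) ?(ltW T0) ?(ltW q_lt1) ?(ltW T1).
have q2 : q ^+ 2 = s * mu by rewrite sqr_sqrtr// mulr_ge0// ltW.
have abE : q / T n.+1 * (q * T n.+1) = s * mu.
  by rewrite -[RHS]q2; field; rewrite gt_eqF.
have mix : (1 - q / T n.+1 * (q * T n.+1)) *: extrapolation S s mu x n.+1 =
    (1 - q / T n.+1) *: x n.+1 + (q / T n.+1 - q / T n.+1 * (q * T n.+1)) *: z n.+1.
  by rewrite abE; exact: (extrapolation_mix pS s_gt0 mu_gt0 q_lt1 (average n)).
have := accelerated_step ipP mu_gt0 L_gt0 f_sc G_lip s_bd a01 b01 abE mix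
  (average n.+1) (prox_ineq n).
have growth := damping_growth pS q01 n.
have gap0 := gap_ge0 n.
rewrite -/(gap n) -/(gap n.+1) /energy.
have cE : (q / T n.+1) ^+ 2 / (2 * s) = mu / 2 / T n.+1 ^+ 2.
  rewrite expr_div_n q2; field.
  by rewrite !gt_eqF.
rewrite cE; move: growth gap0 T0.
move: (gap n) (gap n.+1) (`|_| ^+ 2) (`|z n.+1 - xs| ^+ 2) (T n.+1) (T n) => d d' D' D t' t.
move=> growth gap0 t0 step.
have c0 : 0 < 2 / mu * t' ^+ 2 by rewrite !mulr_gt0 ?invr_gt0 ?exprn_gt0.
have := ler_wpM2l (ltW c0) step.
have -> : 2 / mu * t' ^+ 2 * (d' + mu / 2 / t' ^+ 2 * D') = 2 / mu * t' ^+ 2 * d' + D'.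
  by field; rewrite !gt_eqF.
move=> /le_trans; apply.
have -> : 2 / mu * t' ^+ 2 * ((1 - q / t') * d + mu / 2 / t' ^+ 2 * (1 - q * t') * D) =
   2 / mu * (t' ^+ 2 - q * t') * d + (1 - q * t') * D.
  by field; rewrite !gt_eqF.
rewrite [leRHS]mulrDr lerD2r [leRHS]mulrA ler_wpM2r//.
by rewrite [leRHS]mulrCA ler_wpM2l// divr_ge0// ltW.
Qed.

(** T_n >= q, so the energy controls the gap with a constant factor. *)
Lemma gap_rate : exists2 C : R, 0 <= C & forall n, gap n <= C * (1 - q) ^+ n.
Proof.
have [C C0 prodC] := prod_damping_le pS q01.
have energy_ge0 n : 0 <= energy n.
  by rewrite addr_ge0 ?sqr_ge0// mulr_ge0 ?gap_ge0// mulr_ge0 ?sqr_ge0// divr_ge0// ltW.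
have energy_le n : energy n <= energy 0 * \prod_(j < n) (1 - q * T j.+1).
  elim: n => [|n IHn]; first by rewrite big_ord0 mulr1.
  apply: le_trans (energy_contraction n) _.
  rewrite big_ord_recr/= mulrA [leRHS]mulrC ler_wpM2l// subr_ge0.
  have T0 : 0 < T n.+1 by exact: damping_gt0 pS s_gt0 mu_gt0 q_lt1 _.
  have /andP[qT T1] := damping_bounds pS q01 n.+1.
  by rewrite mulr_ile1 ?(ltW q_gt0) ?(ltW T0) ?(ltW q_lt1) ?(ltW T1).
exists (mu / 2 / q ^+ 2 * (energy 0 * C)).
  by rewrite mulr_ge0 ?mulr_ge0 ?energy_ge0 ?invr_ge0 ?sqr_ge0// ltW.
move=> n.
have c0 : 0 < 2 / mu * q ^+ 2 by rewrite !mulr_gt0 ?invr_gt0 ?exprn_gt0.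
rewrite -(ler_pM2l c0).
have -> : 2 / mu * q ^+ 2 * (mu / 2 / q ^+ 2 * (energy 0 * C) * (1 - q) ^+ n) =
    energy 0 * C * (1 - q) ^+ n.
  by move: (energy 0) ((1 - q) ^+ n) => e r; field; rewrite !gt_eqF.
apply: (@le_trans _ _ (energy n)).
  rewrite /energy -[leLHS]addr0 lerD ?sqr_ge0//.
  rewrite ler_wpM2r ?gap_ge0// ler_pM2l ?divr_gt0//.
  have /andP[qT _] := damping_bounds pS q01 n.
  by rewrite ler_pXn2r ?nnegrE ?(ltW q_gt0)// (le_trans _ qT)// ltW.
apply: le_trans (energy_le n) _.
by rewrite -mulrA ler_wpM2l.
Qed.

End EnergyDecay.

(** * Geometric bounds and the limit of vanishing modulus *)

(** With t = sqrt rho = 1 / (1 + h), Bernoulli's inequality gives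
    k t^k <= 1 / h. *)
Lemma sqr_geometric_bounded {R : realType} (rho : R) : 0 < rho < 1 ->
  exists2 K : R, 0 <= K & forall k : nat, k%:R ^+ 2 * rho ^+ k <= K.
Proof.
move=> /andP[rho0 rho1]; set t := Num.sqrt rho.
have t0 : 0 < t by rewrite sqrtr_gt0.
have t2 : t ^+ 2 = rho by rewrite sqr_sqrtr// ltW.
have t1 : t < 1 by rewrite -(sqrtr1 R) ltr_sqrt.
pose h := t^-1 - 1.
have h0 : 0 < h by rewrite subr_gt0 invf_gt1.
have tk_le (k : nat) : k%:R * t ^+ k <= h^-1.
  have tE : t = (1 + h)^-1 by rewrite addrC subrK invrK.
  have -> : k%:R * t ^+ k = k%:R / (1 + h) ^+ k by rewrite {1}tE exprVn.
  have h1 : 0 < (1 + h) ^+ k by rewrite exprn_gt0// addr_gt0.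
  rewrite ler_pdivrMr// [leRHS]mulrC ler_pdivlMr//; clear h1.
  elim: k => [|k IHk]; first by rewrite mul0r expr0 ler01.
  rewrite exprS mulrDl mul1r -natr1 mulrDl mul1r addrC.
  have : 1 <= (1 + h) ^+ k by rewrite exprn_ege1// lerDl ltW.
  by move=> /(ler_wpM2l (ltW h0)); move: IHk; lra.
exists (h^-1 ^+ 2) => [|k]; first exact: sqr_ge0.
have -> : k%:R ^+ 2 * rho ^+ k = (k%:R * t ^+ k) ^+ 2 by rewrite exprMn -t2 -!exprM mulnC.
by rewrite ler_pXn2r// nnegrE ?mulr_ge0 ?exprn_ge0 ?invr_ge0// ltW.
Qed.

Lemma geometric_le_min {R : realType} (rho C : R) : 0 < rho < 1 -> 0 <= C ->
  exists D : R, forall k : nat, (1 <= k)%N ->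
    C * rho ^+ k <= D * Num.min (k%:R ^+ 2)^-1 (rho ^+ k).
Proof.
move=> rho01 C0; have [K K0 hK] := sqr_geometric_bounded rho01.
have /andP[rho0 _] := rho01.
exists (C * (1 + K)) => k k1; rewrite -mulrA ler_wpM2l//.
have kk : 0 < k%:R ^+ 2 :> R by rewrite exprn_gt0// ltr0n.
have rk : 0 < rho ^+ k by rewrite exprn_gt0.
have [_|_] := leP ((k%:R ^+ 2)^-1 : R) (rho ^+ k).
  rewrite ler_pdivlMr// mulrC; apply: le_trans (hK k) _.
  by rewrite lerDr.
by rewrite ler_peMl ?(ltW rk)// lerDl.
Qed.

Section SmallModulusLimit.
Context {R : realType}.
Variables (kappa : R) (S : R -> R) (s : R).
Hypotheses (pS : profile_properties kappa S) (s_gt0 : 0 < s).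
Hypothesis kappa_gt0 : 0 < kappa.

(** The factorization of S (c q) through q, in Caratheodory's form, removes the
    0 / 0 indeterminacy of beta at mu = 0. *)
Lemma profile_slope (c : R) : 0 <= c -> exists w : R -> R,
  [/\ w q @[q --> 0^'+] --> c * kappa & forall q, 0 < q -> S (c * q) = w q * q].
Proof.
move=> c0.
have d0 : is_derive (c * 0) 1 S kappa.
  rewrite mulr0; apply: DeriveDef; first exact: (profile_derivable pS).
  by rewrite -derive1E (profile_derive_0 pS).
have dl : is_derive (0 : R) 1 (fun x => c * x) c.
  have := @is_deriveZ _ _ _ _ c _ _ _ (is_derive_id (0 : R) 1).
  by rewrite -[_ *: _]/(_ * _) mulr1.
have /is_derive1_caratheodory[w [wE wc w0]] :=
  @is_derive1_comp R S (fun x => c * x) _ _ _ d0 dl.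
exists w; split.
  by rewrite mulrC -w0; apply: cvg_at_right_filter; exact: wc.
by move=> q _; have := wE q; rewrite /= mulr0 (profile_0 pS) !subr0.
Qed.

(** As a function of q = sqrt (s m), both T_n - q and T_(n+1) are q times a
    function with a limit at 0; the factors q cancel in beta. *)
Lemma beta_cvg_0 n :
  beta S s m n.+1 @[m --> 0^'+] --> n%:R * kappa / (1 + n.+1%:R * kappa).
Proof.
have [w [wc wE]] := profile_slope (ler0n R n).
have [w' [wc' wE']] := profile_slope (ler0n R n.+1).
pose B q := ((1 - q) * w q) * (1 - q * (q * (1 + (1 - q) * w' q)))
  / ((1 - q ^+ 2) * (1 + (1 - q) * w' q)).
have idc : q @[q --> (0 : R)^'+] --> (0 : R) by apply: cvg_at_right_filter; exact: cvg_id.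
have Bc : B q @[q --> 0^'+] --> n%:R * kappa / (1 + n.+1%:R * kappa).
  have c1 : 1 - q @[q --> (0 : R)^'+] --> (1 - 0 : R) by apply: cvgB => //; exact: cvg_cst.
  have c2 : 1 + (1 - q) * w' q @[q --> 0^'+] --> 1 + (1 - 0) * (n.+1%:R * kappa).
    by apply: cvgD; [exact: cvg_cst|exact: cvgM].
  rewrite (_ : n%:R * kappa / (1 + n.+1%:R * kappa) =
    ((1 - 0) * (n%:R * kappa)) * (1 - 0 * (0 * (1 + (1 - 0) * (n.+1%:R * kappa))))
    * ((1 - 0 * 0) * (1 + (1 - 0) * (n.+1%:R * kappa)))^-1); last first.
    by rewrite !mul0r !subr0 !mul1r mulr1.
  apply: cvgM.
    apply: cvgM; first exact: cvgM.
    by apply: cvgB; [exact: cvg_cst|apply: cvgM => //; exact: cvgM].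
  apply: cvgV.
    by rewrite mul0r subr0 !mul1r gt_eqF// ltr_pwDl// mulr_ge0// ltW.
  by apply: cvgM => //; apply: cvgB; [exact: cvg_cst|exact: cvgM].
have qc : Num.sqrt (s * m) @[m --> 0^'+] --> (0 : R)^'+.
  move=> A A0; have A0' : \forall y \near (0 : R), 0 < y -> A y by [].
  have cv : Num.sqrt (s * m) @[m --> 0^'+] --> (0 : R).
    have sc : s * m @[m --> (0 : R)^'+] --> s * 0.
      by apply: cvgMr; apply: cvg_at_right_filter; exact: cvg_id.
    by have := cvg_comp _ _ sc (@sqrt_continuous R (s * 0)); rewrite mulr0 sqrtr0.
  move: A0' => /cv; rewrite !near_simpl => nA; near=> m.
  apply: (near nA m) => //.
  have m0 : 0 < m by near: m; exact: nbhs_right_gt.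
  by rewrite sqrtr_gt0 mulr_gt0.
apply: cvg_trans (cvg_comp _ _ qc Bc); apply: near_eq_cvg; near=> m.
have m0 : (0 : R) < m by near: m; exact: nbhs_right_gt.
have q0 : 0 < Num.sqrt (s * m) by rewrite sqrtr_gt0 mulr_gt0.
have q1 : Num.sqrt (s * m) < 1.
  rewrite -(sqrtr1 R) ltr_sqrt// -ltr_pdivlMl// mulr1.
  near: m; apply: nbhs_right_lt.
  by rewrite invr_gt0.
rewrite /= (betaE pS s_gt0 m0 q1) /B /damping wE// wE'//.
have T0 : Num.sqrt (s * m) + (1 - Num.sqrt (s * m)) *
    (w' (Num.sqrt (s * m)) * Num.sqrt (s * m)) != 0.
  by rewrite -wE'// -/(damping S _ n.+1) gt_eqF// (damping_gt0 pS s_gt0 m0 q1).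
move: (Num.sqrt (s * m)) q0 q1 T0 => q q0 q1 T0.
have T0' : 1 + (1 - q) * w' q != 0.
  apply: contra_neq T0 => T'0.
  have -> : q + (1 - q) * (w' q * q) = q * (1 + (1 - q) * w' q) by ring.
  by rewrite T'0 mulr0.
have q2 : 1 - q ^+ 2 != 0 by rewrite subr_eq0 eq_sym lt_eqF// exprn_ilt1// ltW.
by field; rewrite T0 q2.
Unshelve. all: by end_near. Qed.

End SmallModulusLimit.

(** * The two schemes *)

Section Schemes.
Context {R : realType} {H : completeNormedModType R}.
Variable ip : {dot H for idfun}.
Hypothesis ipP : inner_product ip.
Variables (f : H -> R) (g : H -> \bar R) (mu L s : R).
Hypotheses (mu_gt0 : 0 < mu) (L_gt0 : 0 < L).
Hypothesis f_sc : strongly_convex ip f mu.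
Hypothesis grad_lip : L.-lipschitz (grad ip f).
Hypotheses (g_proper : proper_efun g) (g_lsc : lower_semicontinuous g).
Hypothesis g_convex : econvex g.
Hypothesis s_bd : 0 < s <= L^-1.
Variables (kappa : R) (S : R -> R).
Hypothesis pS : profile_properties kappa S.
Local Notation q := (Num.sqrt (s * mu)).
Local Notation T := (damping S q).
Local Notation G := (grad ip f).
Hypothesis q_lt1 : q < 1.
Variables (xs : H) (gs : R).
Hypothesis g_xs : g xs = gs%:E.
Hypothesis xs_min : forall v (a : R), g v = a%:E -> f xs + gs <= f v + a.

Let s_gt0 : 0 < s. Proof. by case/andP: s_bd. Qed.
Let q_gt0 : 0 < q. Proof. exact: sqrt_coeff_gt0. Qed.
Let q01 : 0 < q < 1. Proof. by rewrite q_gt0. Qed.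
Let g_ninfty := proj1 g_proper.
Let T_gt0 n : 0 < T n. Proof. exact: (damping_gt0 pS s_gt0 mu_gt0 q_lt1). Qed.

Let G_lip u v : `|G u - G v| <= L * `|u - v|.
Proof. by have := @grad_lip (u, v) (conj Logic.I Logic.I). Qed.

Let minorant := minimizer_minorant ipP mu_gt0 f_sc G_lip g_proper g_convex g_xs xs_min.

Let prox_fin lambda u : 0 < lambda -> exists a : R, g (prox lambda g u) = a%:E.
Proof. exact: (prox_real ipP g_proper g_lsc g_convex minorant). Qed.

Let prox_ineq lambda u w (a b : R) : 0 < lambda ->
  g (prox lambda g u) = a%:E -> g w = b%:E ->
  a <= b + lambda^-1 * ip (u - prox lambda g u) (prox lambda g u - w).
Proof. exact: (prox_le ipP g_proper g_lsc g_convex minorant). Qed.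

Let a_bd n : 0 <= q / T n <= 1.
Proof.
have /andP[qT _] := damping_bounds pS q01 n.
apply/andP; split; first by rewrite divr_ge0// ltW.
by rewrite ler_pdivrMr// mul1r.
Qed.

(** There is no second sequence here: z is defined so that x_(n+1) is the
    prescribed average of x_n and z_(n+1).  The proximal inequality is used at
    x_(n+1) and at the minimizer, with weights 1 - a and a. *)
Lemma one_sequence_rate x : one_sequence ip f g S s mu x ->
  exists gx : nat -> R, (forall n, g (x n.+1) = (gx n)%:E) /\
  exists2 C : R, 0 <= C & forall n, gap f xs gs x gx n <= C * (1 - q) ^+ n.
Proof.
move=> [x0dom x1E xS].
have x_fin n : exists a : R, g (x n.+1) = a%:E.
  case: n => [|n]; first by rewrite x1E; exact: edomainP.
  by rewrite xS//; exact: prox_fin.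
have [gx gxE] := choice x_fin; exists gx; split=> //.
have a0 n : q / T n != 0 by rewrite mulf_neq0 ?invr_eq0 ?gt_eqF.
pose z n := x n.-1 + (q / T n.-1)^-1 *: (x n - x n.-1).
have average n : x n.+1 = (1 - q / T n) *: x n + (q / T n) *: z n.+1.
  rewrite /z /= scalerDr scalerA mulfV// scale1r addrA -scalerDl subrK scale1r.
  by rewrite addrC subrK.
apply: (gap_rate ipP mu_gt0 L_gt0 f_sc G_lip s_bd pS q_lt1 (z := z)) => //.
  by move=> n; exact: xs_min.
move=> n; set y := extrapolation _ _ _ _ _; set a := q / T n.+1.
set b := q * T n.+1.
have mix := extrapolation_mix pS s_gt0 mu_gt0 q_lt1 (average n).
have xE := xS n.+1 isT; rewrite /= -/y in xE.
have px := gxE n.+1; rewrite xE in px.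
have := prox_ineq s_gt0 px (gxE n); have := prox_ineq s_gt0 px g_xs.
rewrite -xE; move: (G y) => w.
have abE : a * b = s * mu.
  have q2 : q ^+ 2 = s * mu by rewrite sqr_sqrtr// mulr_ge0// ltW.
  by rewrite -[RHS]q2 /a /b; field; rewrite gt_eqF.
have yE : y = (1 - a) *: x n.+1 + a *: ((1 - b) *: z n.+1 + b *: y).
  by apply: averaged_extrapolation; rewrite abE.
set v := _ + b *: y in yE *.
have x'E : x n.+2 - (1 - a) *: x n.+1 - a *: xs = a *: (z n.+2 - xs).
  by rewrite (average n.+1) -/a [_ + a *: z _]addrC addrK scalerBr.
have y_x' : y - x n.+2 = a *: (v - z n.+2).
  by rewrite {1}yE (average n.+1) -/a opprD addrACA subrr add0r -scalerBr.
have a1 : 0 <= 1 - a by rewrite subr_ge0; case/andP: (a_bd n.+1).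
have a_ge0 : 0 <= a by case/andP: (a_bd n.+1).
move=> /(ler_wpM2l a_ge0) le_s /(ler_wpM2l a1) le_x.
clearbody a z; rewrite x'E (ipZr ipP) -addrA.
have -> : a ^+ 2 / s * ip (v - z n.+2) (z n.+2 - xs) - a * ip w (z n.+2 - xs) =
   s^-1 * ip (y - s *: w - x n.+2) (x n.+2 - (1 - a) *: x n.+1 - a *: xs).
  rewrite x'E [y - _ - _]addrAC y_x' !(ipDl ipP, ipZl ipP, ipNl ipP, ipZr ipP).
  by field; rewrite gt_eqF.
move: le_s le_x; rewrite !(ipDr ipP, ipNr ipP, ipZr ipP).
move: (ip _ (x n.+2)) (ip _ xs) (ip _ (x n.+1)) => i1 i2 i3.
move: (gx n.+1) (gx n) => g1 g0. lra.
Qed.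

(** The proximal inequality at the minimizer controls g at z_(n+2), and the
    convexity of g transfers the bound to the average x_(n+2). *)
Lemma two_sequence_rate x z : two_sequence ip f g S s mu x z ->
  exists gx : nat -> R, (forall n, g (x n.+1) = (gx n)%:E) /\
  exists2 C : R, 0 <= C & forall n, gap f xs gs x gx n <= C * (1 - q) ^+ n.
Proof.
move=> [x0dom x1E z1E step].
have tau_gt0 n : 0 < Num.sqrt s * theta S s mu n.+1.
  by rewrite (prox_stepE S s_gt0 mu_gt0)// divr_gt0// mulr_gt0.
have z_fin n : exists a : R, g (z n.+2) = a%:E.
  by have [-> _] := step n.+1 isT; exact: prox_fin.
have [gz gzE] := choice z_fin.
have average n : x n.+1 = (1 - q / T n) *: x n + (q / T n) *: z n.+1.
  case: n => [|n].
    by rewrite x1E z1E -scalerDl subrK scale1r.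
  by have [_ ->] := step n.+1 isT; rewrite (averaging_coeffE pS s_gt0 mu_gt0 q_lt1).
have x_fin n : exists a : R, g (x n.+1) = a%:E.
  elim: n => [|n [a ga]]; first by rewrite x1E; exact: edomainP.
  have a01 : 0 <= 1 - q / T n.+1 <= 1 by move: (a_bd n.+1); lra.
  have [e ge _] := econvex_real g_ninfty g_convex a01 ga (gzE n).
  by exists e; rewrite average -ge subKr.
have [gx gxE] := choice x_fin; exists gx; split=> //.
apply: (gap_rate ipP mu_gt0 L_gt0 f_sc G_lip s_bd pS q_lt1 (z := z)) => //.
  by move=> n; exact: xs_min.
move=> n; set y := extrapolation _ _ _ _ _; set a := q / T n.+1.
set b := q * T n.+1.
have a01 : 0 <= 1 - a <= 1 by move: (a_bd n.+1); rewrite -/a; lra.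
have gx_le : gx n.+1 <= (1 - a) * gx n + a * gz n.
  have [e ge] := econvex_real g_ninfty g_convex a01 (gxE n) (gzE n).
  rewrite subKr; have := gxE n.+1; rewrite average -/a.
  by rewrite subKr in ge; rewrite ge => -[->].
have [zE _] := step n.+1 isT; rewrite /= -/(extrapolation S s mu x n.+1) -/y in zE.
have pz := gzE n; rewrite zE in pz.
have := prox_ineq (tau_gt0 n.+1) pz g_xs.
rewrite -zE (damping_coeffE S s_gt0 mu_gt0) -/b.
rewrite (prox_stepE S s_gt0 mu_gt0); move: (G y) => w.
have -> : s * T n.+1 / q = s / a by rewrite /a invf_div mulrA.
have a0 : 0 < a by rewrite divr_gt0.
have -> : z n.+1 - b *: (z n.+1 - y) - (s / a) *: w - z n.+2 =
    (1 - b) *: z n.+1 + b *: y - z n.+2 - (s / a) *: w.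
  have -> : z n.+1 - b *: (z n.+1 - y) = (1 - b) *: z n.+1 + b *: y.
    by rewrite scalerBr scalerBl scale1r opprB addrA addrAC.
  by rewrite addrAC.
move: (_ + b *: y - _) => d.
have -> : x n.+2 - (1 - a) *: x n.+1 - a *: xs = a *: (z n.+2 - xs).
  by rewrite (average n.+1) -/a [_ + a *: z _]addrC addrK scalerBr.
rewrite !(ipDl ipP, ipZl ipP, ipNl ipP, ipZr ipP) => /(ler_wpM2l (ltW a0)) gz_le.
apply: (le_trans gx_le); rewrite -!addrA lerD2l.
apply: (le_trans gz_le); rewrite le_eqVlt; apply/orP; left; apply/eqP.
by field; rewrite !gt_eqF.
Qed.

End Schemes.

(** * Conclusion *)

Theorem corollary3p4 (R : realType) (kappa p : R)
    (hkappa : 0 < kappa <= 2^-1) (hp : 1 < p) :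
  (forall S, profiles kappa p S -> profile_properties kappa S) /\
  forall (H : completeNormedModType R) (ip : {dot H for idfun})
    (ip_norm : forall x : H, `|x| = Num.sqrt (ip x x))
    (f : H -> R) (g : H -> \bar R) (mu L s : R),
  0 < mu -> 0 < L -> mu < L ->
  continuously_differentiable ip f -> strongly_convex ip f mu -> L.-lipschitz (grad ip f) ->
  proper_efun g -> lower_semicontinuous g -> econvex g ->
  let Phi := (fun x => (f x)%:E + g x)%E in
  argmin Phi !=set0 ->
  let Phi_star := ereal_inf (range Phi) in
  0 < s <= L^-1 ->
  forall S, profiles kappa p S ->
  let gamma := 1 + kappa^-1 in
  [/\ 3 <= gamma,
      forall k : nat, (1 <= k)%N ->
        beta S s m k @[m --> 0^'+] --> (k%:R - 1) / (k%:R + gamma - 1),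
      beta S s mu k @[k --> \oo]
        --> (1 - Num.sqrt (s * mu)) / (1 + Num.sqrt (s * mu)) &
      forall x : nat -> H,
        one_sequence ip f g S s mu x \/
        (exists z : nat -> H, two_sequence ip f g S s mu x z) ->
        exists C : R, forall k : nat, (1 <= k)%N ->
          (Phi (x k) - Phi_star <=
           (C * Num.min (k%:R ^+ 2)^-1 ((1 - Num.sqrt (s * mu)) ^+ k))%:E)%E].
Proof.
have /andP[k0 k2] := hkappa.
split; first by move=> S; exact: profiles_properties.
move=> H ip ip_norm f g mu L s mu0 L0 muL _ f_sc grad_lip g_proper g_lsc g_convex
  Phi [xs xs_argmin] Phi_star s_bd S /(profiles_properties hkappa hp) pS gamma.
have /andP[s0 sL] := s_bd.
have ipP := dot_inner_product ip_norm.
have g_ninfty := proj1 g_proper.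
have q1 : Num.sqrt (s * mu) < 1.
  rewrite -(sqrtr1 R) ltr_sqrt//; apply: (@lt_le_trans _ _ (s * L)).
    by rewrite ltr_pM2l.
  by rewrite -ler_pdivlMr// mul1r.
have q0 : 0 < Num.sqrt (s * mu) by rewrite sqrtr_gt0 mulr_gt0.
split.
- rewrite /gamma -lerBlDl; apply: (@le_trans _ _ (2^-1)^-1); first by rewrite invrK; lra.
  by rewrite lef_pV2 ?posrE ?invr_gt0.
- case=> // n _.
  have -> : (n.+1%:R - 1) / (n.+1%:R + gamma - 1) = n%:R * kappa / (1 + n.+1%:R * kappa).
    have n0 : 0 <= n.+1%:R * kappa by rewrite mulr_ge0// ltW.
    rewrite -natr1 addrK /gamma addrA addrAC addrK.
    by field; rewrite natr1 !gt_eqF// ltr_pwDl.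
  exact: beta_cvg_0.
- exact: (beta_cvg_oo pS s0 mu0 q1).
move=> x schemes.
have [x0 x0dom] := proj2 g_proper.
have [b gx0] := edomainP g_ninfty x0dom.
have [gs g_xs] : exists gs : R, g xs = gs%:E.
  have := xs_argmin x0; rewrite /Phi gx0 -(@EFinD R).
  by have := g_ninfty xs; case: (g xs) => // a _ _; exists a.
have xs_min v (a : R) : g v = a%:E -> f xs + gs <= f v + a.
  by move=> gv; have := xs_argmin v; rewrite /Phi g_xs gv -!(@EFinD R) lee_fin.
have Phi_starE : Phi_star = (f xs + gs)%:E.
  apply/le_anti/andP; split.
    by apply: ereal_inf_lbound; exists xs => //; rewrite /Phi g_xs.
  apply: le_ereal_inf_tmp => _ [v _ <-].
  by have := xs_argmin v; rewrite /Phi {1}g_xs.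
have [gx [gxE [C C0 rate]]] : exists gx : nat -> R, (forall n, g (x n.+1) = (gx n)%:E) /\
    exists2 C : R, 0 <= C & forall n, gap f xs gs x gx n <= C * (1 - Num.sqrt (s * mu)) ^+ n.
  case: schemes => [one|[z two]].
    exact: (one_sequence_rate ipP mu0 L0 f_sc grad_lip g_proper g_lsc g_convex
      s_bd pS q1 g_xs xs_min one).
  exact: (two_sequence_rate ipP mu0 L0 f_sc grad_lip g_proper g_lsc g_convex
      s_bd pS q1 g_xs xs_min two).
have rho01 : 0 < 1 - Num.sqrt (s * mu) < 1 by apply/andP; split; lra.
have /andP[rho0 _] := rho01.
(* The rate for x n.+1 is in (1 - q)^n, one factor 1 - q short of (1 - q)^n.+1,
   hence the division of the constant by 1 - q. *)
have [D hD] := geometric_le_min rho01 (divr_ge0 C0 (ltW rho0)).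
exists D; case=> // n _.
rewrite Phi_starE /Phi gxE -(@EFinD R).
rewrite -[X in (X <= _)%E]/((f (x n.+1) + gx n - (f xs + gs))%:E) lee_fin.
apply: le_trans (hD n.+1 isT); apply: le_trans (rate n) _.
by rewrite exprS mulrA divfK// gt_eqF.
Qed.
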